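(* Let $(X,\mathcal A,T,\mu)$ be a dynamical system and let $f:X\to Y\subset\mathbb R^N$ be a Lipschitz observation such that $\underline C_{f_*\mu}>0$. Suppose that the following two conditions hold. (H1) For all $\psi,\phi\in\mathcal H^\alpha(Y,\mathbb R)$ and all $n\in\mathbb N^*$, $$\left|\int_X\psi(f(T^nx))\,\phi(f(x))\,d\mu(x)-\int_X\psi\circ f\,d\mu\int_X\phi\circ f\,d\mu\right|\le\|\psi\circ f\|_\alpha\,\|\phi\circ f\|_\alpha\,\theta_n$$ with $\theta_n=a^n$ and $a\in[0,1)$. (HA) There exist $r_0>0$, $\xi\ge0$ and $\beta>0$ such that for $f_*\mu$-almost every $y\in\mathbb R^N$ and any $r_0>r>\rho>0$, $$f_*\mu\big(B(y,r+\rho)\setminus B(y,r-\rho)\big)\le r^{-\xi}\rho^\beta.$$ Then for $\mu\otimes\mu$-almost every $(x,y)\in X\times X$, $$\liminf_{n\to\infty}\frac{\log m_n^f(x,y)}{-\log n}\ge\frac{2}{\overline C_{f_*\mu}}.$$ Furthermore, if $C_{f_*\mu}$ exists, then for $\mu\otimes\mu$-almost every $(x,y)\in X\times X$, $$\lim_{n\to\infty}\frac{\log m_n^f(x,y)}{-\log n}=\frac{2}{C_{f_*\mu}}.$$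
   Context: A dynamical system $(X,\mathcal A,T,\mu)$ consists of a metric space $(X,d)$, a $\sigma$-algebra $\mathcal A$ on $X$, a measurable map $T:X\to X$ and a $T$-invariant probability measure $\mu$ on $(X,\mathcal A)$, i.e. $\mu(T^{-1}A)=\mu(A)$ for all $A\in\mathcal A$. An observation is a measurable function $f:X\to Y\subset\mathbb R^N$. The shortest distance between two observed orbits is $$m_n^f(x,y)=\min_{i,j=0,\dots,n-1} d\big(f(T^ix),f(T^jy)\big),$$ where $d$ on $Y\subset\mathbb R^N$ is the distance of $\mathbb R^N$ (with $\log0=-\infty$). The pushforward measure is $f_*\mu(\cdot)=\mu(f^{-1}(\cdot))$, regarded as a probability measure on $Y\subset\mathbb R^N$. For a probability measure $\nu$ on a metric space $Z$, the lower and upper correlation dimensions are $$\underline C_\nu=\liminf_{r\to0}\frac{\log\int_Z\nu(B(z,r))\,d\nu(z)}{\log r},\qquad \overline C_\nu=\limsup_{r\to0}\frac{\log\int_Z\nu(B(z,r))\,d\nu(z)}{\log r},$$ where $B(z,r)$ is the ball of center $z$ and radius $r$; if the limit exists, the common value is denoted $C_\nu$. $\mathcal H^\alpha(Z,\mathbb R)$ denotes the space of Hölder observables on a metric space $Z$ with a fixed exponent $\alpha\in(0,1]$, i.e. functions $\psi:Z\to\mathbb R$ with finite Hölder norm $\|\psi\|_\alpha=\sup_Z|\psi|+\sup_{z\ne z'}\frac{|\psi(z)-\psi(z')|}{d(z,z')^\alpha}$. In (H1) the norms $\|\psi\circ f\|_\alpha$, $\|\phi\circ f\|_\alpha$ are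 those of functions on $X$. *)

(* Defs.v *)
From HB Require Import structures.
From mathcomp Require Import all_boot all_order all_algebra.
From mathcomp Require Import all_classical all_reals all_analysis.
From mathcomp Require Import ring.
Import Order.TTheory GRing.Theory Num.Theory.
Import numFieldNormedType.Exports.

Set Implicit Arguments.
Unset Strict Implicit.
Unset Printing Implicit Defensive.

Local Open Scope classical_set_scope.
Local Open Scope ring_scope.

(* A metric space with a sigma-algebra, not required to be related to the
   metric. *)
#[short(type="metricMeasurableType")]
HB.structure Definition MetricMeasurable (R : numDomainType)
    (d : measure_display) :=
  {T of Metric R T & Measurable d T}.

(* R^N with the Euclidean distance and its Borel sigma-algebra. The alias is
   needed because the library equips 'rV[R]_N with the sup norm. *)
Definition euclidean (R : realType) (N : nat) : Type := 'rV[R]_N.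

Section euclidean_metric.
Variables (R : realType) (N : nat).

HB.instance Definition _ := Choice.on (euclidean R N).
HB.instance Definition _ := isPointed.Build (euclidean R N) (0 : 'rV[R]_N).

Definition euclidean_dist (x y : euclidean R N) : R :=
  Num.sqrt (\sum_(i < N) (x ord0 i - y ord0 i) ^+ 2).

Lemma euclidean_distxx x : euclidean_dist x x = 0.
Proof.
by rewrite /euclidean_dist big1 ?sqrtr0// => i _; rewrite subrr expr0n.
Qed.

Lemma euclidean_dist_eq0 x y : euclidean_dist x y = 0 -> x = y.
Proof.
move=> /eqP; rewrite sqrtr_eq0 => s0.
apply/rowP => i; apply/eqP; rewrite -subr_eq0 -sqrf_eq0.
have/psumr_eq0P : \sum_(j < N) (x ord0 j - y ord0 j) ^+ 2 = 0.
  by apply/le_anti; rewrite s0 sumr_ge0// => j _; exact: sqr_ge0.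
by move=> -> // j _; exact: sqr_ge0.
Qed.

Lemma euclidean_dist_sym x y : euclidean_dist x y = euclidean_dist y x.
Proof. by congr Num.sqrt; apply: eq_bigr => i _; rewrite -sqrrN opprB. Qed.

Lemma sum_cauchy_schwarz (a b : 'I_N -> R) :
  (\sum_i a i * b i) ^+ 2 <= (\sum_i a i ^+ 2) * (\sum_i b i ^+ 2).
Proof.
set S := \sum_i a i * b i; set A := \sum_i a i ^+ 2; set B := \sum_i b i ^+ 2.
have A0 : 0 <= A by apply: sumr_ge0 => i _; exact: sqr_ge0.
have : 0 <= \sum_i (A * b i - S * a i) ^+ 2.
  by apply: sumr_ge0 => i _; exact: sqr_ge0.
have -> : \sum_i (A * b i - S * a i) ^+ 2 = A * (A * B - S ^+ 2).
  transitivity (A ^+ 2 * B + (- 2 * A * S) * S + S ^+ 2 * A); last by ring.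
  have -> : A ^+ 2 * B = \sum_i A ^+ 2 * b i ^+ 2 by rewrite mulr_sumr.
  have -> : - 2 * A * S * S = \sum_i - 2 * A * S * (a i * b i).
    by rewrite -mulr_sumr.
  have -> : S ^+ 2 * A = \sum_i S ^+ 2 * a i ^+ 2 by rewrite mulr_sumr.
  rewrite -!big_split/=.
  by apply: eq_bigr => i _; ring.
have [A_gt0|] := ltP 0 A; first by rewrite pmulr_rge0// subr_ge0.
move=> A_le0 _; have Az : A = 0 by apply/le_anti; rewrite A_le0 A0.
have a0 i : a i = 0.
  apply/eqP; rewrite -sqrf_eq0; apply/eqP.
  by move/psumr_eq0P : Az; apply => // j _; exact: sqr_ge0.
by rewrite Az mul0r /S big1 ?expr0n// => i _; rewrite a0 mul0r.
Qed.

Lemma euclidean_dist_triangle y x z :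
  euclidean_dist x z <= euclidean_dist x y + euclidean_dist y z.
Proof.
pose a i := x ord0 i - y ord0 i; pose b i := y ord0 i - z ord0 i.
have A0 : 0 <= \sum_i a i ^+ 2 by apply: sumr_ge0 => i _; exact: sqr_ge0.
have B0 : 0 <= \sum_i b i ^+ 2 by apply: sumr_ge0 => i _; exact: sqr_ge0.
rewrite -(@ler_pXn2r _ 2)// ?nnegrE ?addr_ge0 ?sqrtr_ge0//.
rewrite sqrrD !sqr_sqrtr//; last by apply: sumr_ge0 => i _; exact: sqr_ge0.
rewrite -/(\sum_i a i ^+ 2) -/(\sum_i b i ^+ 2) -sqrtrM//.
have -> : \sum_(i < N) (x ord0 i - z ord0 i) ^+ 2 =
    \sum_i a i ^+ 2 + (\sum_i a i * b i) *+ 2 + \sum_i b i ^+ 2.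
  by rewrite -sumrMnl -!big_split/=; apply: eq_bigr => i _; rewrite /a /b; ring.
rewrite lerD2r lerD2l lerMn2r/= (le_trans (ler_norm _))//.
by rewrite -sqrtr_sqr ler_wsqrtr// sum_cauchy_schwarz.
Qed.

HB.instance Definition _ := isMetric.Build R (euclidean R N)
  euclidean_distxx euclidean_dist_eq0 euclidean_dist_sym
  euclidean_dist_triangle.

HB.instance Definition _ := Measurable.copy (euclidean R N)
  (g_sigma_algebraType (@open (euclidean R N))).

End euclidean_metric.

Section definitions.
Variables (R : realType) (d : measure_display) (Z : metricMeasurableType R d).
Local Open Scope ereal_scope.

(* `lne 0 = -oo`, and `ball z r` is the open ball
   `[set z' | mdist z z' < r]`. *)
Definition corr_ratio (nu : probability Z R) (r : R) : \bar R :=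
  lne (\int[nu]_z nu (ball z r)) / (ln r)%:E.

Definition lower_corr_dim (nu : probability Z R) : \bar R :=
  limf_einf (corr_ratio nu) 0^'+.

Definition upper_corr_dim (nu : probability Z R) : \bar R :=
  limf_esup (corr_ratio nu) 0^'+.

Definition is_corr_dim (nu : probability Z R) (C : \bar R) : Prop :=
  corr_ratio nu r @[r --> 0^'+] --> C.

(* Holder norm of the restriction of `psi` to the subspace `D`; it depends only
   on that restriction. The point 0 makes the seminorm vanish when `D` is a
   singleton (the supremum is taken in [0, +oo]). *)
Definition holder_norm (D : set Z) (alpha : R) (psi : Z -> R) : \bar R :=
  ereal_sup [set `|psi z|%:E | z in D] +
  ereal_sup ([set 0] `|`
    [set (`|psi z.1 - psi z.2| / mdist z.1 z.2 `^ alpha)%:E |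
       z in [set z : Z * Z | [/\ D z.1, D z.2 & z.1 != z.2]]]).

Definition holder (D : set Z) (alpha : R) (psi : Z -> R) : Prop :=
  holder_norm D alpha psi < +oo.

Definition annulus_regular (nu : probability Z R) : Prop :=
  exists r0 xi beta : R,
    [/\ (0 < r0)%R, (0 <= xi)%R, (0 < beta)%R &
      {ae nu, forall y, forall r rho : R, (0 < rho < r)%R -> (r < r0)%R ->
        nu (ball y (r + rho)%R `\` ball y (r - rho)%R) <=
        (r `^ (- xi) * rho `^ beta)%:E}].

End definitions.

Section observed_orbits.
Variables (R : realType) (N : nat).
Variables (d : measure_display) (X : metricMeasurableType R d).

(* The default value of the iterated minima is the (i, j) = (0, 0) term, so it
   does not affect the minimum when n >= 1. *)
Definition shortest_dist (T : X -> X) (f : X -> euclidean R N) (n : nat)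
    (x y : X) : R :=
  \big[Num.min/mdist (f x) (f y)]_(i < n)
    \big[Num.min/mdist (f x) (f y)]_(j < n)
      mdist (f (iter i T x)) (f (iter j T y)).

Definition dist_ratio (T : X -> X) (f : X -> euclidean R N) (x y : X)
    (n : nat) : \bar R :=
  (lne (shortest_dist T f n x y)%:E / (- ln n%:R)%:E)%E.

(* A function Y -> R is represented by any extension of it to R^N: only its
   values on Y, which contains the range of `f`, matter. *)
Definition exponential_decay (mu : probability X R) (T : X -> X)
    (Y : set (euclidean R N)) (f : X -> euclidean R N) (alpha : R) : Prop :=
  exists a : R, (0 <= a < 1)%R /\
    forall psi phi : euclidean R N -> R,
      holder Y alpha psi -> holder Y alpha phi ->
      forall n : nat, (0 < n)%N ->
        (`|\int[mu]_x (psi (f (iter n T x)) * phi (f x))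
           - (\int[mu]_x psi (f x)) * (\int[mu]_x phi (f x))|%:E
         <= holder_norm setT alpha (psi \o f) *
            holder_norm setT alpha (phi \o f) * (a ^+ n)%:E)%E.

End observed_orbits.

(* Main.v *)
Require Import Defs.
From HB Require Import structures.
From mathcomp Require Import all_boot all_order all_algebra.
From mathcomp Require Import all_classical all_reals all_analysis.
From mathcomp Require Import measurable_realfun.
From mathcomp Require Import ring lra.
Import Order.TTheory GRing.Theory Num.Theory.
Import numFieldNormedType.Exports.
Local Open Scope classical_set_scope.
Local Open Scope ring_scope.

(** Let [nu] be the law of the observation, and [Phi r] ([corr_int]) its
    correlation integral: the probability that two independent points of law [nu]
    are at distance less than [r]. The dimensions say that [Phi r] behaves like
    [r ^ C], and the claim is that the shortest distance between [n] points of one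
    orbit and [n] points of another is about the scale [r] at which the expected
    number [n ^ 2 * Phi r] of close pairs becomes of order one.

    That the distance is not smaller follows from the union bound over the
    [n ^ 2] pairs of times ([probability_shortest_dist_lt]): at [n = 2 ^ k] and
    [r = n ^ (- s)] with [s > 2 / C] the probabilities are summable, so the
    Borel-Cantelli lemma applies ([ae_dist_ratio_le]). Since the shortest distance
    decreases with [n], bounds along a geometric sequence of times extend to all
    times with an arbitrarily small loss in the exponent ([interpolate_le],
    [interpolate_ge]).

    That the distance is not larger is a second moment argument
    ([second_moment_bound], [encounter_probability]). Close pairs are counted with
    the Lipschitz kernel [tent r], which lies between half the indicator of
    distance less than [r / 2] and the indicator of distance less than [r], and
    only at [m] times that are multiples of a gap [g]. Let [M] be the mean of the
    kernel for [nu \x nu]; then [M >= Phi (r / 2) / 2], and the mean of the count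
    is [m ^ 2 * M]. Two pairs of times that differ on both orbits are almost
    uncorrelated: decay of correlations is used once on each orbit, for a section
    of the kernel and for the average of these sections, both of which are
    Lipschitz. Two pairs of times that differ on only one orbit have correlation at
    most about [kappa * M], where [kappa] bounds the [nu]-measure of all balls of
    radius [r]. In Euclidean space such a ball is covered by boundedly many sets
    [A] of diameter less than [r / 2] ([euclidean_half_covering]), for which
    [nu A ^ 2 <= Phi (r / 2)], hence [kappa] is of the order of
    [sqrt (Phi (r / 2))] ([measure_ball_le_corr_int]). By Chebyshev's inequality
    the probability that no pair is close is then at most of the order of
    [1 / x + 1 / x ^ 2], with [x = m * sqrt (Phi (r / 2))], plus a mixing error
    proportional to [a ^ g]. With [n = m * g], [m = 2 ^ (p * k)] and [g = 4 ^ k],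
    the mixing error is super-exponentially small in [k], while for large [p] the
    number [m] equals [n] up to a small loss in the exponent; thus [x] grows
    geometrically in [k] when [r = n ^ (- s)] with [s < 2 / C], and the
    Borel-Cantelli lemma applies again ([ae_dist_ratio_ge]). *)

Set Implicit Arguments.
Unset Strict Implicit.
Unset Printing Implicit Defensive.

(** * Integration of bounded measurable functions *)

(** A real function that is measurable and bounded; such functions form an
    algebra, are integrable for every probability measure, and satisfy Fubini's
    theorem without further conditions. *)
Definition bounded_measurable {d} {T : measurableType d} {R : realType}
    (g : T -> R) : Prop :=
  measurable_fun setT g /\ exists c : R, forall x, `|g x| <= c.

Section bounded_measurable_algebra.
Context {d} {T : measurableType d} {R : realType}.
Implicit Types g h : T -> R.

Lemma bounded_measurable01 g : measurable_fun setT g ->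
  (forall x, 0 <= g x <= 1) -> bounded_measurable g.
Proof.
move=> mg g01; split=> //; exists 1 => x.
by have /andP[g0 g1] := g01 x; rewrite ger0_norm.
Qed.

Lemma bounded_measurable_cst (c : R) : bounded_measurable (fun _ : T => c).
Proof. by split; [exact: measurable_cst | exists `|c|]. Qed.

Lemma bounded_measurableD g h : bounded_measurable g -> bounded_measurable h ->
  bounded_measurable (fun x => g x + h x).
Proof.
move=> [mg [a ga]] [mh [b hb]]; split; first exact: measurable_funD.
by exists (a + b) => x; rewrite (le_trans (ler_normD _ _))// lerD.
Qed.

Lemma bounded_measurableM g h : bounded_measurable g -> bounded_measurable h ->
  bounded_measurable (fun x => g x * h x).
Proof.
move=> [mg [a ga]] [mh [b hb]]; split; first exact: measurable_funM.
by exists (a * b) => x; rewrite normrM ler_pM.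
Qed.

Lemma bounded_measurable_sum (I : Type) (s : seq I) (G : I -> T -> R) :
  (forall i, bounded_measurable (G i)) ->
  bounded_measurable (fun x => \sum_(i <- s) G i x).
Proof.
move=> bG; elim: s => [|i s ih].
  by under eq_fun do rewrite big_nil; exact: bounded_measurable_cst.
by under eq_fun do rewrite big_cons; exact: bounded_measurableD.
Qed.

Lemma bounded_measurable_comp {d'} {U : measurableType d'} (k : U -> T) g :
  measurable_fun setT k -> bounded_measurable g ->
  bounded_measurable (fun x => g (k x)).
Proof.
move=> mk [mg [c gc]]; split; first exact: measurableT_comp mg mk.
by exists c => x; exact: gc.
Qed.

Lemma bounded_measurable_indic (A : set T) : measurable A ->
  bounded_measurable (\1_A : T -> R).
Proof.
move=> mA; apply: bounded_measurable01 => [|x]; first exact: measurable_indic.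
by rewrite indicE; case: (_ \in _); rewrite /= ?lexx ?ler01.
Qed.

End bounded_measurable_algebra.

Section bounded_measurable_integral.
Context {d} {T : measurableType d} {R : realType}.
Variable P : probability T R.
Implicit Types g h : T -> R.

Lemma bounded_measurable_integrable g : bounded_measurable g ->
  P.-integrable setT (EFin \o g).
Proof.
move=> [mg [c gc]]; apply: measurable_bounded_integrable => //.
  by rewrite -ge0_fin_numE ?measure_ge0 ?fin_num_measure.
exists c; split; first exact: num_real.
by move=> M cM x _ /=; rewrite (le_trans (gc x))// ltW.
Qed.

Lemma Rintegral_fin g : bounded_measurable g ->
  (\int[P]_x (g x)%:E)%E = (\int[P]_x g x)%:E.
Proof.
move=> /bounded_measurable_integrable ig; rewrite /Rintegral fineK//.
exact: integrable_fin_num.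
Qed.

Lemma Rintegral_const (c : R) : \int[P]_(x in setT) c = c.
Proof.
rewrite Rintegral_cst// [fine _](_ : _ = 1) ?mulr1//.
exact: (congr1 fine (probability_setT P)).
Qed.

Lemma le_Rintegral_bounded g h : bounded_measurable g -> bounded_measurable h ->
  (forall x, g x <= h x) -> \int[P]_x g x <= \int[P]_x h x.
Proof.
by move=> bg bh gh; apply: le_Rintegral => //;
  exact: bounded_measurable_integrable.
Qed.

Lemma RintegralD_bounded g h : bounded_measurable g -> bounded_measurable h ->
  \int[P]_x (g x + h x) = \int[P]_x g x + \int[P]_x h x.
Proof.
by move=> bg bh; rewrite RintegralD//; exact: bounded_measurable_integrable.
Qed.

Lemma RintegralZ_bounded (c : R) g : bounded_measurable g ->
  \int[P]_x (c * g x) = c * \int[P]_x g x.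
Proof.
by move=> bg; rewrite RintegralZl//; exact: bounded_measurable_integrable.
Qed.

Lemma Rintegral_sum_bounded (I : Type) (s : seq I) (G : I -> T -> R) :
  (forall i, bounded_measurable (G i)) ->
  \int[P]_x (\sum_(i <- s) G i x) = \sum_(i <- s) \int[P]_x G i x.
Proof.
move=> bG; elim: s => [|i s ih].
  by rewrite big_nil; under eq_Rintegral do rewrite big_nil;
    rewrite Rintegral_const.
rewrite big_cons -ih; under eq_Rintegral do rewrite big_cons.
by rewrite RintegralD_bounded//; exact: bounded_measurable_sum.
Qed.

Lemma Rintegral_indic (A : set T) : measurable A ->
  (\int[P]_x (\1_A x : R))%:E = P A.
Proof.
move=> mA; rewrite -Rintegral_fin; last exact: bounded_measurable_indic.
by rewrite integral_indic// setIT.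
Qed.

Lemma Rintegral01 g : bounded_measurable g -> (forall x, 0 <= g x <= 1) ->
  0 <= \int[P]_x g x <= 1.
Proof.
move=> bg g01; apply/andP; split.
  by apply: Rintegral_ge0 => x _; have /andP[] := g01 x.
rewrite -[leRHS]Rintegral_const; apply: le_Rintegral_bounded => //.
  exact: bounded_measurable_cst.
by move=> x; have /andP[] := g01 x.
Qed.

(** Invariance of a measure, transferred from sets to integrals along all
    iterates of the map. *)
Lemma Rintegral_iter (t : {mfun T >-> T}) g (n : nat) :
  (forall A, measurable A -> P (t @^-1` A) = P A) -> bounded_measurable g ->
  \int[P]_x g (iter n t x) = \int[P]_x g x.
Proof.
move=> tP; elim: n g => // n ih g bg.
have bgt : bounded_measurable (fun x => g (t x)).
  exact: bounded_measurable_comp bg.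
transitivity (\int[P]_x g (t x)); first exact: (ih (fun x => g (t x))).
rewrite /Rintegral; congr fine.
have ig := bounded_measurable_integrable bgt.
have mt : measurable_fun setT t by exact: measurable_funPT.
transitivity (\int[pushforward P t]_x (g x)%:E)%E.
  by rewrite (integral_pushforward mt)//; apply/measurable_EFinP; case: bg.
by apply: eq_measure_integral => A mA _; exact: tP.
Qed.

End bounded_measurable_integral.

Lemma measurable_iter {d} {T : measurableType d} (t : {mfun T >-> T}) (n : nat) :
  measurable_fun setT (iter n t).
Proof.
elim: n => [|n ih]; first exact: measurable_id.
exact: (measurableT_comp (measurable_funPT t) ih).
Qed.

Section fubini_bounded.
Context {d d'} {T : measurableType d} {U : measurableType d'} {R : realType}.
Variables (P : probability T R) (Q : probability U R).
Variable F : T * U -> R.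
Hypothesis bF : bounded_measurable F.

Lemma bounded_measurable_sec1 x : bounded_measurable (fun y => F (x, y)).
Proof. apply: bounded_measurable_comp bF; exact: measurable_pair1. Qed.

Lemma bounded_measurable_sec2 y : bounded_measurable (fun x => F (x, y)).
Proof. apply: bounded_measurable_comp bF; exact: measurable_pair2. Qed.

Let iF : (P \x Q)%E.-integrable setT (EFin \o F).
Proof. exact: bounded_measurable_integrable. Qed.

Lemma bounded_measurable_fubini1 :
  bounded_measurable (fun x => \int[Q]_y F (x, y)).
Proof.
split.
  apply/measurable_EFinP.
  apply: (eq_measurable_fun (fubini_F Q (EFin \o F))); last first.
    exact: measurable_fubini_F iF.
  move=> x _ /=; rewrite -Rintegral_fin//; exact: bounded_measurable_sec1.
have [_ [c Fc]] := bF; exists c => x.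
have bs := bounded_measurable_sec1 x.
rewrite (le_trans (le_normr_Rintegral _ _))//.
  exact: bounded_measurable_integrable.
rewrite -[leRHS](Rintegral_const Q); apply: le_Rintegral_bounded => //.
  by case: bs => ms _; split; [exact: measurableT_comp | exists c => y; rewrite normr_id].
exact: bounded_measurable_cst.
Qed.

Lemma Rfubini1 : \int[(P \x Q)%E]_z F z = \int[P]_x \int[Q]_y F (x, y).
Proof.
rewrite {1}/Rintegral -(integral12_prod_meas1 iF) {1}/Rintegral.
congr fine; apply: eq_integral => x _; rewrite -Rintegral_fin//.
exact: bounded_measurable_sec1.
Qed.

Lemma Rfubini2 : \int[(P \x Q)%E]_z F z = \int[Q]_y \int[P]_x F (x, y).
Proof.
rewrite {1}/Rintegral -(integral21_prod_meas1 iF) {1}/Rintegral.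
congr fine; apply: eq_integral => x _; rewrite -Rintegral_fin//.
exact: bounded_measurable_sec2.
Qed.

End fubini_bounded.

(** * Euclidean space *)

(** In a metric space with this property, every ball is covered by a fixed number
    of measurable sets of at most half its radius in diameter; the finite type
    [I] indexes the covering. *)
Definition half_covering {R : realType} {d} (Z : metricMeasurableType R d) :
    Prop :=
  exists I : finType, forall (u : Z) (r : R), 0 < r ->
    exists C : I -> set Z, [/\ forall i, measurable (C i),
      forall i v w, C i v -> C i w -> mdist v w < r / 2 &
      forall v, ball u r v -> exists i, C i v].

Section euclidean_space.
Context {R : realType} {N : nat}.
Local Notation E := (euclidean R N).
Implicit Types u v w : E.

Lemma mdistE u v : mdist u v = Num.sqrt (\sum_(i < N) (u ord0 i - v ord0 i) ^+ 2).
Proof. by []. Qed.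

Lemma ler_coord_mdist u v (i : 'I_N) : `|u ord0 i - v ord0 i| <= mdist u v.
Proof.
rewrite mdistE -sqrtr_sqr ler_wsqrtr// (bigD1 i)//= lerDl.
by apply: sumr_ge0 => j _; exact: sqr_ge0.
Qed.

Lemma mdist_le_coord u v (a : R) : 0 <= a ->
  (forall i, `|u ord0 i - v ord0 i| <= a) -> mdist u v <= N%:R * a.
Proof.
move=> a0 uva; rewrite mdistE -[leRHS]ger0_norm ?mulr_ge0//.
rewrite -sqrtr_sqr ler_wsqrtr//.
apply: (@le_trans _ _ (\sum_(i < N) a ^+ 2)).
  by apply: ler_sum => i _; rewrite -[leLHS]real_normK ?num_real// lerXn2r ?nnegrE.
rewrite sumr_const card_ord -(mulr_natl (a ^+ 2)) exprMn ler_wpM2r ?sqr_ge0//.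
by rewrite -natrX ler_nat; case: (N) => // n; rewrite expnS leq_pmulr// expn_gt0.
Qed.

Lemma measurable_coord (i : 'I_N) : measurable_fun setT (fun u : E => u ord0 i).
Proof.
apply: (measurability (@RGenOInfty.G R)); first exact: RGenOInfty.measurableE.
move=> _ [_ [a ->] <-]; rewrite setTI.
suff : open ((fun u : E => u ord0 i) @^-1` `]a, +oo[) by exact: sub_sigma_algebra.
rewrite openE => u /=.
rewrite in_itv/= andbT => au.
rewrite /interior -nbhs_ballE; exists (u ord0 i - a); first by rewrite /= subr_gt0.
move=> v; rewrite ballEmdist/= in_itv/= andbT => uv.
have := le_lt_trans (ler_coord_mdist u v i) uv.
by rewrite ltr_norml => /andP[_]; lra.
Qed.

Lemma measurable_mdist {d} {T : measurableType d} (p q : T -> E) :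
  measurable_fun setT p -> measurable_fun setT q ->
  measurable_fun setT (fun x => mdist (p x) (q x)).
Proof.
move=> mp mq; under eq_fun do rewrite mdistE.
apply: (@measurableT_comp _ _ _ _ _ _ (@Num.sqrt R)).
  apply: continuous_measurable_fun; exact: sqrt_continuous.
apply: measurable_sum => i; apply: measurable_funX; apply: measurable_funB.
  exact: (measurableT_comp (measurable_coord i) mp).
exact: (measurableT_comp (measurable_coord i) mq).
Qed.

Lemma measurable_mdist_lt {d} {T : measurableType d} (p q : T -> E) (r : R) :
  measurable_fun setT p -> measurable_fun setT q ->
  measurable [set x | mdist (p x) (q x) < r].
Proof.
move=> mp mq; have := measurable_mdist mp mq.
move=> /(_ measurableT _ (measurable_itv `]-oo, r[)); rewrite setTI.
by congr measurable; apply/seteqP; split => x /=; rewrite in_itv.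
Qed.

(** The cell [c] of the grid of mesh [m] centred at [u]. *)
Definition grid_cell (m : R) u (c : {ffun 'I_N -> 'I_(4 * N + 4)}) : set E :=
  [set v | forall i : 'I_N,
     u ord0 i + ((c i)%:R - (2 * N + 2)%:R) * m <= v ord0 i
       < u ord0 i + ((c i)%:R + 1 - (2 * N + 2)%:R) * m].

Lemma measurable_grid_cell m u c : measurable (grid_cell m u c).
Proof.
have -> : grid_cell m u c = \bigcap_(i in [set: 'I_N])
    ((fun v : E => v ord0 i) @^-1`
      `[u ord0 i + ((c i)%:R - (2 * N + 2)%:R) * m,
        u ord0 i + ((c i)%:R + 1 - (2 * N + 2)%:R) * m[).
  apply/seteqP; split => v; first by move=> cv i _ /=; rewrite in_itv/=; exact: cv.
  by move=> cv i; have /= := cv i Logic.I; rewrite in_itv.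
apply: fin_bigcap_measurable => // i _.
by rewrite -[X in measurable X]setTI; exact: measurable_coord.
Qed.

Lemma mdist_grid_cell m u c v w : 0 < m ->
  grid_cell m u c v -> grid_cell m u c w -> mdist v w < (N%:R + 1) * m.
Proof.
move=> m0 cv cw; apply: (@le_lt_trans _ _ (N%:R * m)); last by rewrite ltr_pM2r// ltrDl.
apply: mdist_le_coord; first exact: ltW.
move=> i; have := cv i; have := cw i; rewrite ler_norml; nra.
Qed.

Lemma ball_sub_grid m u v : 0 < m -> mdist u v < (2 * N + 2)%:R * m ->
  exists c, grid_cell m u c v.
Proof.
move=> m0 uv.
pose t i := (v ord0 i - u ord0 i) / m + (2 * N + 2)%:R.
have tE i : (t i - (2 * N + 2)%:R) * m = v ord0 i - u ord0 i.
  by rewrite /t addrK divfK// gt_eqF.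
have t0 i : 0 <= t i < (4 * N + 4)%:R.
  have := le_lt_trans (ler_coord_mdist u v i) uv; rewrite ltr_norml -mulNr.
  have -> : u ord0 i - v ord0 i = ((2 * N + 2)%:R - t i) * m.
    by have := tE i; lra.
  have -> : (4 * N + 4)%:R = 2 * (2 * N + 2)%:R :> R.
    by rewrite -natrM mulnDr mulnA.
  by rewrite !ltr_pM2r// => /andP[? ?]; apply/andP; split; lra.
pose c := [ffun i : 'I_N => inord (Num.truncn (t i)) : 'I_(4 * N + 3).+1].
have N4 : (4 * N + 4 = (4 * N + 3).+1)%N by rewrite addnS.
exists [ffun i => cast_ord (esym N4) (c i)] => i.
rewrite ffunE /= ffunE.
have /andP[ti0 ti1] := t0 i.
rewrite inordK; last by rewrite -(ltr_nat R) -N4 (le_lt_trans _ ti1)// truncn_le.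
have := truncn_itv ti0; rewrite -natr1 => /andP[tl tu].
have := tE i.
set q := (Num.truncn (t i))%:R in tl tu *; set b := _%:R => tEi.
have : (q - b) * m <= (t i - b) * m by rewrite ler_pM2r//; lra.
have : (t i - b) * m < (q + 1 - b) * m by rewrite ltr_pM2r//; lra.
by rewrite tEi; lra.
Qed.

(** A ball of radius [r] is covered by boundedly many cells of diameter less
    than [r / 2]. *)
Lemma euclidean_half_covering : half_covering E.
Proof.
exists {ffun 'I_N -> 'I_(4 * N + 4)} => u r r0.
(* the mesh is such that [(N + 1) * m = r / 2] *)
pose m := r / (2 * (N%:R + 1)) : R.
have N0 : 0 < N%:R + 1 :> R by rewrite ltr_wpDl.
have m0 : 0 < m by rewrite divr_gt0// mulr_gt0.
have mr : (N%:R + 1) * m = r / 2 by rewrite /m; field; rewrite gt_eqF.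
have mr2 : (2 * N + 2)%:R * m = r by rewrite natrD natrM; have := mr; lra.
exists (grid_cell m u); split => [c|c v w|v].
- exact: measurable_grid_cell.
- by rewrite -mr; exact: mdist_grid_cell.
- by rewrite ballEmdist/= -mr2 => /(ball_sub_grid m0).
Qed.

End euclidean_space.

(** * The correlation integral *)

(** The correlation integral of a probability measure at scale [r], as a real
    number: the probability that two independent points are [r]-close. *)
Definition corr_int {R : realType} {d} {Z : metricMeasurableType R d}
    (nu : probability Z R) (r : R) : R :=
  fine (\int[nu]_z nu (ball z r))%E.

Section correlation_integral.
Context {R : realType} {d} {E : metricMeasurableType R d}.
Hypothesis mdistE : measurable_fun setT (fun p : E * E => mdist p.1 p.2).
Variable nu : probability E R.
Implicit Types (u v w : E) (A : set E) (r : R).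

Lemma measurable_near_diag r :
  measurable [set p : E * E | mdist p.1 p.2 < r].
Proof.
have := mdistE measurableT (measurable_itv `]-oo, r[); rewrite setTI.
by congr measurable; apply/seteqP; split => p /=; rewrite in_itv.
Qed.

Lemma corr_intE r :
  (\int[nu]_z nu (ball z r))%E = (nu \x nu)%E [set p : E * E | mdist p.1 p.2 < r].
Proof.
rewrite /product_measure1; apply: eq_integral => z _ /=.
by congr (nu _); rewrite ballEmdist; apply/seteqP; split => w /=;
  rewrite /xsection/= inE.
Qed.

Lemma corr_int_fin r : (corr_int nu r)%:E = (\int[nu]_z nu (ball z r))%E.
Proof.
rewrite /corr_int fineK// corr_intE.
apply: (fin_num_measure ((nu \x nu)%E : probability _ R)); exact: measurable_near_diag.
Qed.

(** Two independent points that both fall in a set of diameter less than [r] are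
    [r]-close. *)
Lemma measure_small_set_le A r : measurable A ->
  (forall v w, A v -> A w -> mdist v w < r) ->
  fine (nu A) ^+ 2 <= corr_int nu r.
Proof.
move=> mA Ar; rewrite -lee_fin corr_int_fin corr_intE expr2 EFinM.
rewrite fineK ?fin_num_measure// -product_measure1E//.
apply: le_measure; rewrite ?inE; [exact: measurableX | exact: measurable_near_diag |].
by move=> p [/= ? ?]; exact: Ar.
Qed.

(** Each set of a covering by sets of diameter less than [r / 2] has a measure
    whose square is at most the correlation integral at scale [r / 2]. *)
Lemma measure_ball_le_corr_int : half_covering E ->
  exists K : R, 0 <= K /\ forall u r, 0 < r ->
    fine (nu (ball u r)) <= K * Num.sqrt (corr_int nu (r / 2)).
Proof.
move=> [I cover]; exists #|I|%:R; split=> // u r r0.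
have [C [mC Cd Cu]] := cover u r r0.
have mb : measurable (ball u r).
  rewrite ballEmdist; have := measurable_xsection u (measurable_near_diag r).
  by congr measurable; apply/seteqP; split => w /=; rewrite /xsection/= inE.
have bi A : measurable A -> bounded_measurable (\1_A : E -> R).
  exact: bounded_measurable_indic.
have nuE A : measurable A -> fine (nu A) = \int[nu]_v (\1_A v : R).
  by move=> mA; apply: EFin_inj; rewrite Rintegral_indic// fineK// fin_num_measure.
rewrite nuE//.
apply: (@le_trans _ _ (\int[nu]_v \sum_(c : I) (\1_(C c) v : R))).
  apply: le_Rintegral_bounded; first exact: bi.
    by apply: bounded_measurable_sum => c; exact: bi.
  move=> v; have [|vb] := pselect (ball u r v); last first.
    by rewrite indicE memNset//=; exact: sumr_ge0.
  move=> vb; have [c cv] := Cu _ vb; rewrite indicE mem_set//=.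
  by rewrite (bigD1 c)//= indicE mem_set//= lerDl; exact: sumr_ge0.
rewrite Rintegral_sum_bounded; last by move=> c; exact: bi.
apply: (@le_trans _ _ (\sum_(c : I) Num.sqrt (corr_int nu (r / 2)))); last first.
  by rewrite sumr_const mulr_natl.
apply: ler_sum => c _; rewrite -nuE//.
rewrite -[leLHS]ger0_norm ?fine_ge0// -sqrtr_sqr ler_wsqrtr//.
by apply: measure_small_set_le => // v w; exact: Cd.
Qed.

End correlation_integral.

(** * The second moment method for encounters of two orbits *)

Section second_moment.
Context {d} {X : measurableType d} {R : realType}.
Variables (mu : probability X R) (t : {mfun X >-> X}) (k : X * X -> R).
Hypothesis t_inv : forall A, measurable A -> mu (t @^-1` A) = mu A.
Hypothesis mk : measurable_fun setT k.
Hypothesis k01 : forall z, 0 <= k z <= 1.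
Hypothesis kC : forall x y, k (x, y) = k (y, x).

Let G x := \int[mu]_y k (x, y).
Let M := \int[mu]_x G x.

Variables (kappa eps : R).
Hypothesis eps0 : 0 <= eps.
Hypothesis G_le : forall x, G x <= kappa.
Hypothesis k_mixing : forall x x' n, (0 < n)%N ->
  \int[mu]_y (k (x, iter n t y) * k (x', y)) <= G x * G x' + eps.
Hypothesis G_mixing : forall n, (0 < n)%N ->
  \int[mu]_x (G (iter n t x) * G x) <= M ^+ 2 + eps.

Let bk : bounded_measurable k.
Proof. exact: bounded_measurable01. Qed.

Let bk1 x : bounded_measurable (fun y => k (x, y)).
Proof. exact: bounded_measurable_sec1 bk x. Qed.

Let bG : bounded_measurable G.
Proof. exact: bounded_measurable_fubini1. Qed.

Let G01 x : 0 <= G x <= 1.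
Proof. exact: Rintegral01. Qed.

Let M01 : 0 <= M <= 1.
Proof. exact: Rintegral01. Qed.

Let kappa0 : 0 <= kappa.
Proof. by have := G_le point; have /andP[] := G01 point; lra. Qed.

Let bk_iter x i : bounded_measurable (fun y => k (x, iter i t y)).
Proof. by apply: bounded_measurable_comp (bk1 x); exact: measurable_iter. Qed.

Let bG_iter i : bounded_measurable (fun x => G (iter i t x)).
Proof. by apply: bounded_measurable_comp bG; exact: measurable_iter. Qed.

Let K i j (z : X * X) : R := k (iter i t z.1, iter j t z.2).

Let bK i j : bounded_measurable (K i j).
Proof.
apply: bounded_measurable_comp bk.
apply: measurable_fun_pair.
  exact: measurableT_comp (measurable_iter t i) measurable_fst.
exact: measurableT_comp (measurable_iter t j) measurable_snd.
Qed.

Let K01 i j z : 0 <= K i j z <= 1. Proof. exact: k01. Qed.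

Lemma Rintegral_encounter i j : \int[(mu \x mu)%E]_z K i j z = M.
Proof.
rewrite Rfubini1//; transitivity (\int[mu]_x G (iter i t x)).
  apply: eq_Rintegral => x _; exact: (Rintegral_iter j t_inv (bk1 (iter i t x))).
exact: (Rintegral_iter i t_inv bG).
Qed.

Lemma Rintegral_kernel_pair x x' j j' : j != j' ->
  \int[mu]_y (k (x, iter j t y) * k (x', iter j' t y)) <= G x * G x' + eps.
Proof.
wlog jj' : x x' j j' / (j' < j)%N => [hw|_].
  rewrite neq_ltn => /orP[jj'|jj'].
    rewrite mulrC [leLHS](_ : _ = \int[mu]_y (k (x', iter j' t y) * k (x, iter j t y))).
      by apply: hw => //; rewrite neq_ltn jj' orbT.
    by apply: eq_Rintegral => y _; rewrite mulrC.
  by apply: hw => //; rewrite neq_ltn jj' orbT.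
have -> : \int[mu]_y (k (x, iter j t y) * k (x', iter j' t y)) =
    \int[mu]_y (k (x, iter (j - j') t y) * k (x', y)).
  rewrite -[RHS](@Rintegral_iter _ _ _ mu t
    (fun y => k (x, iter (j - j') t y) * k (x', y)) j' t_inv).
    by apply: eq_Rintegral => y _; rewrite -iterD subnK// ltnW.
  exact: bounded_measurableM.
by apply: k_mixing; rewrite subn_gt0.
Qed.

Lemma Rintegral_section_pair i i' : i != i' ->
  \int[mu]_x (G (iter i t x) * G (iter i' t x)) <= M ^+ 2 + eps.
Proof.
wlog ii' : i i' / (i' < i)%N => [hw|_].
  rewrite neq_ltn => /orP[ii'|ii'].
    rewrite [leLHS](_ : _ = \int[mu]_y (G (iter i' t y) * G (iter i t y))).
      by apply: hw => //; rewrite neq_ltn ii' orbT.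
    by apply: eq_Rintegral => y _; rewrite mulrC.
  by apply: hw => //; rewrite neq_ltn ii' orbT.
have -> : \int[mu]_x (G (iter i t x) * G (iter i' t x)) =
    \int[mu]_x (G (iter (i - i') t x) * G x).
  rewrite -[RHS](@Rintegral_iter _ _ _ mu t
    (fun x => G (iter (i - i') t x) * G x) i' t_inv).
    by apply: eq_Rintegral => y _; rewrite -iterD subnK// ltnW.
  exact: bounded_measurableM.
by apply: G_mixing; rewrite subn_gt0.
Qed.

Lemma Rintegral_section_sqr i :
  \int[mu]_x (G (iter i t x) * G (iter i t x)) <= kappa * M.
Proof.
rewrite (Rintegral_iter (g := fun x => G x * G x) _ t_inv); last first.
  exact: bounded_measurableM.
rewrite -RintegralZ_bounded//; apply: le_Rintegral_bounded.
- exact: bounded_measurableM.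
- by apply: bounded_measurableM => //; exact: bounded_measurable_cst.
- by move=> x; rewrite ler_wpM2r//; have /andP[] := G01 x.
Qed.

(** The correlation of two encounters: it is close to the product of the means
    as soon as the two time indices differ on both orbits, it is at most of the
    order of [kappa * M] if they differ on only one orbit, and at most [M]
    always. *)
Lemma Rintegral_encounter_pair i j i' j' :
  \int[(mu \x mu)%E]_z (K i j z * K i' j' z) <=
    (M ^+ 2 + 2 * eps) + (i == i')%:R * (kappa * M + eps)
    + (j == j')%:R * (kappa * M + eps) + (i == i')%:R * (j == j')%:R * M.
Proof.
have /andP[M0 _] := M01.
have kM : 0 <= kappa * M by exact: mulr_ge0.
have M2 : 0 <= M ^+ 2 by exact: sqr_ge0.
have e2 : 0 <= 2 * eps by exact: mulr_ge0.
have base0 : 0 <= M ^+ 2 + 2 * eps by exact: addr_ge0.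
have side0 : 0 <= kappa * M + eps by exact: addr_ge0.
have bKK : bounded_measurable (fun z => K i j z * K i' j' z).
  exact: bounded_measurableM.
have [jj'|jj'] := eqVneq j j'; last first.
  rewrite Rfubini1//.
  apply: (@le_trans _ _
      (\int[mu]_x (G (iter i t x) * G (iter i' t x) + eps))).
    apply: le_Rintegral_bounded.
    - exact: bounded_measurable_fubini1 bKK.
    - apply: bounded_measurableD; last exact: bounded_measurable_cst.
      exact: bounded_measurableM.
    - move=> x; exact: (@Rintegral_kernel_pair (iter i t x) (iter i' t x) j j' jj').
  rewrite RintegralD_bounded; last 2 first.
  - exact: bounded_measurableM.
  - exact: bounded_measurable_cst.
  rewrite Rintegral_const mul0r mulr0 mul0r !addr0.
  have [->|ii'] := eqVneq i i'.
    rewrite /= mul1r; apply: (@le_trans _ _ (kappa * M + eps)); last by rewrite lerDr.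
    by rewrite lerD2r; exact: Rintegral_section_sqr.
  rewrite /= mul0r addr0 mulr2n mulrDl mul1r addrA lerD2r.
  exact: Rintegral_section_pair.
have [ii'|ii'] := eqVneq i i'.
  rewrite -{}ii' -{}jj' /= !mul1r.
  apply: (@le_trans _ _ M); last by rewrite lerDr !addr_ge0.
  rewrite -[leRHS](Rintegral_encounter i j); apply: le_Rintegral_bounded => //.
    exact: bounded_measurableM.
  by move=> z; have /andP[] := K01 i j z; nra.
rewrite -{}jj' /= in bKK *; rewrite !mul0r mul1r !addr0 Rfubini2//.
apply: (@le_trans _ _ (kappa * M + eps)); last by rewrite lerDr.
apply: (@le_trans _ _
    (\int[mu]_y (G (iter j t y) * G (iter j t y) + eps))).
  apply: le_Rintegral_bounded.
  - pose sw (z : X * X) := (z.2, z.1).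
    have bKs : bounded_measurable (fun z => K i j (sw z) * K i' j (sw z)).
      apply: (bounded_measurable_comp (k := sw) _ bKK).
      exact: measurable_fun_pair.
    exact: bounded_measurable_fubini1 bKs.
  - apply: bounded_measurableD; last exact: bounded_measurable_cst.
    exact: bounded_measurableM.
  - move=> y; rewrite [leLHS](_ : _ = \int[mu]_x
        (k (iter j t y, iter i t x) * k (iter j t y, iter i' t x))).
      exact: Rintegral_kernel_pair.
    by apply: eq_Rintegral => x _; rewrite /K kC [X in _ * X]kC.
rewrite RintegralD_bounded; last 2 first.
- exact: bounded_measurableM.
- exact: bounded_measurable_cst.
by rewrite Rintegral_const lerD2r Rintegral_section_sqr.
Qed.

Let sum_pairs m (a b c e : R) :
  \sum_(p : 'I_m * 'I_m) \sum_(q : 'I_m * 'I_m)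
    (a + (p.1 == q.1 :> nat)%:R * b + (p.2 == q.2 :> nat)%:R * b
       + (p.1 == q.1 :> nat)%:R * (p.2 == q.2 :> nat)%:R * e) =
  m%:R ^+ 4 * a + 2 * m%:R ^+ 3 * b + m%:R ^+ 2 * e.
Proof.
have delta (i : 'I_m) : \sum_(j < m) (i == j :> nat)%:R = 1 :> R.
  rewrite (bigD1 i)//= eqxx big1 ?addr0// => j ji.
  by rewrite [_ == _](_ : _ = false)//; apply: contraNF ji => /eqP ij; apply/eqP/val_inj.
have sum1 : \sum_(i < m) 1 = m%:R :> R by rewrite sumr_const card_ord.
transitivity (\sum_(p : 'I_m * 'I_m) (m%:R ^+ 2 * a + 2 * m%:R * b + e)).
  apply: eq_bigr => p _.
  rewrite -(pair_bigA _ (fun i j : 'I_m => a + (p.1 == i :> nat)%:R * b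
    + (p.2 == j :> nat)%:R * b + (p.1 == i :> nat)%:R * (p.2 == j :> nat)%:R * e))/=.
  transitivity (\sum_(i < m) (m%:R * a + b + (p.1 == i :> nat)%:R * (m%:R * b + e))).
    apply: eq_bigr => i _.
    rewrite !big_split/= !sumr_const card_ord -!mulr_suml -mulr_sumr !delta.
    by rewrite -[a *+ m]mulr_natl -[_ *+ m]mulr_natl; ring.
  rewrite big_split/= sumr_const card_ord -mulr_suml delta -[_ *+ m]mulr_natl.
  by ring.
rewrite sumr_const card_prod card_ord -[LHS]mulr_natl natrM; ring.
Qed.

(** Chebyshev's inequality for the number of encounters: two orbits of length
    [m] whose points never meet are exceptional as soon as [m ^ 2 * M] is large
    and [kappa], [eps] are small. *)
Lemma second_moment_bound (m : nat) (A : set (X * X)) : measurable A ->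
  (forall z i j, A z -> (i < m)%N -> (j < m)%N ->
     k (iter i t z.1, iter j t z.2) = 0) ->
  fine ((mu \x mu)%E A) * (m%:R ^+ 2 * M) ^+ 2 <=
    m%:R ^+ 2 * M + 2 * m%:R ^+ 3 * (kappa * M + eps) + 2 * m%:R ^+ 4 * eps.
Proof.
move=> mA A0.
pose S z := \sum_(p : 'I_m * 'I_m) K p.1 p.2 z.
have bS : bounded_measurable S by apply: bounded_measurable_sum => p; exact: bK.
have iS : \int[(mu \x mu)%E]_z S z = m%:R ^+ 2 * M.
  rewrite Rintegral_sum_bounded => [|p]; last exact: bK.
  under eq_bigr do rewrite Rintegral_encounter.
  by rewrite sumr_const card_prod card_ord -[LHS]mulr_natl natrM expr2.
have iSS : \int[(mu \x mu)%E]_z (S z * S z) <=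
    m%:R ^+ 4 * (M ^+ 2 + 2 * eps) + 2 * m%:R ^+ 3 * (kappa * M + eps)
    + m%:R ^+ 2 * M.
  have -> : \int[(mu \x mu)%E]_z (S z * S z) = \int[(mu \x mu)%E]_z
      \sum_(p : 'I_m * 'I_m) \sum_(q : 'I_m * 'I_m) (K p.1 p.2 z * K q.1 q.2 z).
    by apply: eq_Rintegral => z _; rewrite /S big_distrlr.
  rewrite Rintegral_sum_bounded => [|p]; last first.
    by apply: bounded_measurable_sum => q; exact: bounded_measurableM.
  rewrite -sum_pairs//; apply: ler_sum => p _.
  rewrite Rintegral_sum_bounded => [|q]; last exact: bounded_measurableM.
  by apply: ler_sum => q _; exact: Rintegral_encounter_pair.
have -> : fine ((mu \x mu)%E A) = \int[(mu \x mu)%E]_z (\1_A z : R).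
  by apply: EFin_inj; rewrite Rintegral_indic// fineK//;
    apply: (fin_num_measure ((mu \x mu)%E : probability _ R)).
set c := m%:R ^+ 2 * M in iS *.
have b1 : bounded_measurable (\1_A : X * X -> R).
  exact: bounded_measurable_indic.
have bc : bounded_measurable (fun z => c ^+ 2 + (- 2 * c) * S z).
  apply: bounded_measurableD; first exact: bounded_measurable_cst.
  by apply: bounded_measurableM => //; exact: bounded_measurable_cst.
have : \int[(mu \x mu)%E]_z (c ^+ 2 * \1_A z) <=
    \int[(mu \x mu)%E]_z (S z * S z + (c ^+ 2 + (- 2 * c) * S z)).
  apply: le_Rintegral_bounded.
  - by apply: bounded_measurableM => //; exact: bounded_measurable_cst.
  - by apply: bounded_measurableD => //; exact: bounded_measurableM.
  - move=> z; have [Az|Az] := pselect (A z).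
      rewrite indicE mem_set//= /S big1 ?mulr0 ?addr0 ?add0r ?mulr1//.
      by move=> p _; exact: A0.
    rewrite indicE memNset//= mulr0.
    by have := sqr_ge0 (S z - c); rewrite sqrrB; lra.
rewrite RintegralZ_bounded// RintegralD_bounded//; last exact: bounded_measurableM.
rewrite RintegralD_bounded; last 2 first.
- exact: bounded_measurable_cst.
- by apply: bounded_measurableM => //; exact: bounded_measurable_cst.
rewrite Rintegral_const RintegralZ_bounded// iS => h.
have cE : c ^+ 2 = m%:R ^+ 4 * M ^+ 2 by rewrite /c; ring.
by move: h iSS; rewrite mulrC; move: cE; rewrite -/c; lra.
Qed.

End second_moment.

(** * Holder norms and the tent kernel *)

Section holder_norm_bounds.
Context {R : realType} {d} {Z : metricMeasurableType R d}.
Implicit Types (D : set Z) (psi : Z -> R).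

Lemma holder_norm_ge0 alpha psi : (0 <= holder_norm setT alpha psi)%E.
Proof.
apply: adde_ge0.
  apply: (@le_trans _ _ (`|psi point|%:E)%E); first by rewrite lee_fin.
  by apply: ereal_sup_ubound; exists point.
by apply: ereal_sup_ubound; left.
Qed.

(** A function with values in [0, 1] and Lipschitz constant [c] has Holder norm
    at most [2 + c]: at distances less than 1 the Lipschitz bound wins, at larger
    distances the bound on the oscillation does. *)
Lemma holder_norm_lipschitz D (alpha c : R) psi : 0 < alpha <= 1 -> 0 <= c ->
  (forall z, 0 <= psi z <= 1) ->
  (forall z z', `|psi z - psi z'| <= c * mdist z z') ->
  (holder_norm D alpha psi <= (2 + c)%:E)%E.
Proof.
move=> /andP[al0 al1] c0 psi01 psiL.
have -> : 2 + c = 1 + (1 + c) by rewrite addrA.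
rewrite EFinD; apply: leeD.
  apply: ge_ereal_sup => _ [z Dz <-]; rewrite lee_fin.
  by have /andP[p0 p1] := psi01 z; rewrite ger0_norm.
apply: ge_ereal_sup => _ [->|[[z z'] [/= Dz Dz' zz'] <-]].
  by rewrite lee_fin addr_ge0.
have d0 : 0 < mdist z z' by rewrite mdist_gt0.
rewrite lee_fin ler_pdivrMr ?powR_gt0//.
have [d1|d1] := leP (mdist z z') 1.
  apply: (le_trans (psiL z z')).
  have dal : mdist z z' <= mdist z z' `^ alpha by rewrite ger1_powR// d0.
  apply: (@le_trans _ _ (c * mdist z z' `^ alpha)); first by rewrite ler_wpM2l.
  by rewrite ler_wpM2r ?powR_ge0// lerDr.
have dal : 1 <= mdist z z' `^ alpha.
  by rewrite -[leLHS](powRr0 (mdist z z')) ler_powR// ltW.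
apply: (@le_trans _ _ 1).
  have := psi01 z; have := psi01 z'; rewrite ler_norml; lra.
by rewrite -[leLHS]mulr1 ler_pM// lerDl.
Qed.

End holder_norm_bounds.

(** A Lipschitz substitute for the indicator of [mdist u v < r]. *)
Definition tent {R : realType} {d} {Z : metricMeasurableType R d} (r : R)
    (u v : Z) : R := Num.max 0 (1 - mdist u v / r).

Section tent_kernel.
Context {R : realType} {d} {Z : metricMeasurableType R d}.
Variable r : R.
Hypothesis r0 : 0 < r.
Implicit Types u v : Z.

Lemma tentC u v : tent r u v = tent r v u.
Proof. by rewrite /tent metric_sym. Qed.

Lemma tent01 u v : 0 <= tent r u v <= 1.
Proof.
rewrite /tent le_max lexx/= ge_max ler01/= gerBl.
by rewrite divr_ge0 ?mdist_ge0// ltW.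
Qed.

Lemma tent_eq0 u v : r <= mdist u v -> tent r u v = 0.
Proof.
by move=> ruv; rewrite /tent max_l// subr_le0 ler_pdivlMr// mul1r.
Qed.

Lemma tent_half u v : mdist u v < r / 2 -> 2^-1 <= tent r u v.
Proof.
move=> uv; rewrite /tent le_max; apply/orP; right.
suff : mdist u v / r <= 2^-1 by lra.
by rewrite ler_pdivrMr// mulrC ltW.
Qed.

Lemma tent_lipschitz u v v' : `|tent r u v - tent r u v'| <= r^-1 * mdist v v'.
Proof.
rewrite /tent [leRHS]mulrC.
have h1 : mdist u v / r <= mdist u v' / r + mdist v v' / r.
  by rewrite -mulrDl ler_pM2r ?invr_gt0// (metric_sym v); exact: metric_triangle.
have h2 : mdist u v' / r <= mdist u v / r + mdist v v' / r.
  by rewrite -mulrDl ler_pM2r ?invr_gt0//; exact: metric_triangle.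
have h3 : 0 <= mdist v v' / r by rewrite divr_ge0 ?mdist_ge0// ltW.
rewrite ler_norml.
case: (leP 0 (1 - mdist u v / r)) => ?; case: (leP 0 (1 - mdist u v' / r)) => ?; lra.
Qed.

End tent_kernel.

Lemma measurable_tent {R : realType} {d} {Z : metricMeasurableType R d}
    {d'} {T : measurableType d'} (r : R) (p q : T -> Z) :
  measurable_fun setT (fun x => mdist (p x) (q x)) ->
  measurable_fun setT (fun x => tent r (p x) (q x)).
Proof.
move=> mpq; apply: measurable_maxr; first exact: measurable_cst.
apply: measurable_funB; first exact: measurable_cst.
by apply: measurable_funM => //; exact: measurable_cst.
Qed.

(** * Encounters of observed orbits *)

Section iterate_mfun.
Context {d} {X : measurableType d} {R : realType}.
Variables (mu : probability X R) (T : {mfun X >-> X}) (g : nat).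

(** The iterate [T ^ g] as a measurable map. *)
Definition iter_mfun (x : X) : X := iter g T x.

HB.instance Definition _ := isMeasurableFun.Build _ _ _ _ iter_mfun
  (measurable_iter T g).

Lemma iter_iter_mfun n x : iter n iter_mfun x = iter (n * g) T x.
Proof. by elim: n => //= n ->; rewrite mulSn /iter_mfun -iterD. Qed.

Lemma iter_mfun_inv : (forall A, measurable A -> mu (T @^-1` A) = mu A) ->
  forall A, measurable A -> mu (iter_mfun @^-1` A) = mu A.
Proof.
move=> Tmu; rewrite /iter_mfun; elim: (g) => // n ih A mA.
rewrite -[RHS]Tmu// -[RHS]ih//.
by rewrite -[X in measurable X]setTI; exact: (measurable_funPT T).
Qed.

End iterate_mfun.

Lemma corr_int_distribution {R : realType} {d} {X : measurableType d} {d'}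
    {Z : metricMeasurableType R d'} (mu : probability X R) (f : {mfun X >-> Z})
    (r : R) :
  measurable_fun setT (fun p : Z * Z => mdist p.1 p.2) ->
  corr_int (distribution mu f) r =
    fine ((mu \x mu)%E [set z : X * X | mdist (f z.1) (f z.2) < r]).
Proof.
move=> mZ; rewrite /corr_int; congr fine.
have mb : measurable_fun setT (fun z => distribution mu f (ball z r)).
  have := measurable_fun_xsection (distribution mu f) (measurable_near_diag mZ r).
  apply: eq_measurable_fun => z _ /=; congr (distribution mu f _).
  by rewrite ballEmdist; apply/seteqP; split => w /=; rewrite /xsection/= inE.
rewrite ge0_integral_distribution//.
rewrite /product_measure1; apply: eq_integral => x _ /=.
rewrite /distribution /pushforward; congr (mu _).
by rewrite ballEmdist; apply/seteqP; split => y /=; rewrite /xsection/= inE.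
Qed.

(** Division of the second moment bound by the squared mean, which is at least
    [(m ^ 2 * Phi / 2) ^ 2]. *)
Lemma second_moment_algebra {R : realType} (p m M K s Phi e : R) :
  1 <= m -> 0 < Phi -> 0 <= K -> 0 <= e -> s = Num.sqrt Phi -> Phi / 2 <= M ->
  p * (m ^+ 2 * M) ^+ 2 <=
    m ^+ 2 * M + 2 * m ^+ 3 * (K * s * M + e) + 2 * m ^+ 4 * e ->
  p <= 2 / (m ^+ 2 * Phi) + 4 * K / (m * s) + 16 * e / Phi ^+ 2.
Proof.
move=> m1 Phi0 K0 e0 sE PhiM pM.
have s0 : 0 < s by rewrite sE sqrtr_gt0.
have ss : Phi = s * s by rewrite sE -expr2 sqr_sqrtr// ltW.
have m0 : 0 < m by exact: lt_le_trans ltr01 m1.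
have M0 : 0 < M by apply: lt_le_trans PhiM; rewrite divr_gt0.
have iM : M^-1 <= 2 / Phi.
  by rewrite -[leRHS]invrK invf_div lef_pV2 ?posrE ?divr_gt0.
have iM0 : 0 <= M^-1 by rewrite invr_ge0 ltW.
have -> : 4 * K / (m * s) = 2 * K * s / m * (2 / Phi).
  by rewrite ss; field; rewrite !gt_eqF.
have -> : 16 * e / Phi ^+ 2 = 4 * e * (2 / Phi) ^+ 2.
  by field; rewrite gt_eqF.
have -> : 2 / (m ^+ 2 * Phi) = m ^- 2 * (2 / Phi).
  by field; rewrite !gt_eqF.
apply: (@le_trans _ _ (m ^- 2 * M^-1 + 2 * K * s / m * M^-1 + 4 * e * M^-1 ^+ 2)).
  have mM0 : 0 < (m ^+ 2 * M) ^+ 2 by rewrite exprn_gt0 ?mulr_gt0 ?exprn_gt0.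
  rewrite -(ler_pM2r mM0); apply: (le_trans pM).
  have -> : (m ^- 2 * M^-1 + 2 * K * s / m * M^-1 + 4 * e * M^-1 ^+ 2) *
      (m ^+ 2 * M) ^+ 2 = m ^+ 2 * M + 2 * m ^+ 3 * (K * s * M) + 4 * m ^+ 4 * e.
    by field; rewrite !gt_eqF.
  have : m ^+ 3 * e <= m ^+ 4 * e.
    by rewrite ler_wpM2r// [m ^+ 4]exprS ler_peMl// exprn_ge0// ltW.
  lra.
apply: lerD; first apply: lerD.
- by rewrite ler_wpM2l// invr_ge0 exprn_ge0// ltW.
- by rewrite ler_wpM2l// divr_ge0 ?mulr_ge0// ltW.
- by rewrite ler_wpM2l ?mulr_ge0// lerXn2r// nnegrE (le_trans iM0).
Qed.

Section observed_encounters.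
Context {R : realType} {N : nat} {d} {X : metricMeasurableType R d}.
Variables (mu : probability X R) (T : {mfun X >-> X}).
Hypothesis T_inv : forall A, measurable A -> mu (T @^-1` A) = mu A.
Variables (Y : set (euclidean R N)) (f : {mfun X >-> euclidean R N}).
Variables (L alpha a : R).
Hypothesis L0 : 0 <= L.
Hypothesis fL : forall x x', mdist (f x) (f x') <= L * mdist x x'.
Hypothesis alpha01 : 0 < alpha <= 1.
Hypothesis a01 : 0 <= a < 1.
Hypothesis decay : forall psi phi : euclidean R N -> R,
  holder Y alpha psi -> holder Y alpha phi ->
  forall n : nat, (0 < n)%N ->
    (`|\int[mu]_x (psi (f (iter n T x)) * phi (f x))
        - (\int[mu]_x psi (f x)) * (\int[mu]_x phi (f x))|%:E
     <= holder_norm setT alpha (psi \o f) *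
        holder_norm setT alpha (phi \o f) * (a ^+ n)%:E)%E.

Let mdist_meas : measurable_fun setT
  (fun p : euclidean R N * euclidean R N => mdist p.1 p.2).
Proof. exact: measurable_mdist. Qed.

(** Decay of correlations along the observation, for observables with values in
    [0, 1] and Lipschitz constant [c]. *)
Lemma mixing_lipschitz (c : R) (psi phi : euclidean R N -> R) (g n : nat) :
  0 <= c ->
  (forall z, 0 <= psi z <= 1) -> (forall z, 0 <= phi z <= 1) ->
  (forall z z', `|psi z - psi z'| <= c * mdist z z') ->
  (forall z z', `|phi z - phi z'| <= c * mdist z z') ->
  (0 < g)%N -> (g <= n)%N ->
  \int[mu]_x (psi (f (iter n T x)) * phi (f x)) <=
    (\int[mu]_x psi (f x)) * (\int[mu]_x phi (f x)) +
    (2 + c * L) ^+ 2 * a ^+ g.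
Proof.
move=> c0 psi01 phi01 psiL phiL g0 gn.
have /andP[a0 a1] := a01.
have hY h : (forall z, 0 <= h z <= 1) ->
    (forall z z', `|h z - h z'| <= c * mdist z z') -> holder Y alpha h.
  move=> h01 hL; apply: le_lt_trans (ltry (2 + c)).
  exact: holder_norm_lipschitz.
have hX h : (forall z, 0 <= h z <= 1) ->
    (forall z z', `|h z - h z'| <= c * mdist z z') ->
    (holder_norm setT alpha (h \o f) <= (2 + c * L)%:E)%E.
  move=> h01 hL; apply: holder_norm_lipschitz => //; first exact: mulr_ge0.
    by move=> x; exact: h01.
  move=> x x' /=; apply: (le_trans (hL _ _)).
  by rewrite -mulrA ler_wpM2l.
have := decay (hY _ psi01 psiL) (hY _ phi01 phiL) (leq_trans g0 gn).
set I := Rintegral _ _ _; set J := Rintegral _ _ _; set J' := Rintegral _ _ _.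
move=> h; rewrite -lerBlDl; apply: (le_trans (ler_norm _)).
rewrite -lee_fin; apply: (le_trans h).
rewrite EFinM expr2 EFinM; apply: lee_pmul.
- by rewrite mule_ge0// holder_norm_ge0.
- by rewrite lee_fin exprn_ge0.
- by apply: lee_pmul; rewrite ?holder_norm_ge0 ?hX.
- by rewrite lee_fin ler_wiXn2l// ltW.
Qed.

(** The probability that two observed orbits, sampled at [m] times with gap [g],
    stay at distance at least [r]. Up to constants it is governed by
    [x = m * sqrt Phi], with an additional error due to imperfect mixing at gap
    [g]. *)
Lemma encounter_probability (K r Phi : R) (m g : nat) (A : set (X * X)) :
  0 < r -> (0 < m)%N -> (0 < g)%N -> 0 <= K ->
  (forall u, fine (distribution mu f (ball u r)) <= K * Num.sqrt Phi) ->
  Phi = corr_int (distribution mu f) (r / 2) -> 0 < Phi ->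
  measurable A ->
  (forall z i j, A z -> (i < m)%N -> (j < m)%N ->
     r <= mdist (f (iter (i * g) T z.1)) (f (iter (j * g) T z.2))) ->
  fine ((mu \x mu)%E A) <=
    2 / (m%:R ^+ 2 * Phi) + 4 * K / (m%:R * Num.sqrt Phi)
    + 16 * ((2 + L / r) ^+ 2 * a ^+ g) / Phi ^+ 2.
Proof.
move=> r0 m0 g0 K0 KPhi PhiE Phi0 mA Ar.
have /andP[a0 a1] := a01.
pose t := iter_mfun T g.
pose k (z : X * X) := tent r (f z.1) (f z.2).
have mk : measurable_fun setT k.
  apply: measurable_tent; apply: measurable_mdist.
    exact: measurableT_comp (measurable_funPT f) measurable_fst.
  exact: measurableT_comp (measurable_funPT f) measurable_snd.
have k01 z : 0 <= k z <= 1 by exact: tent01.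
have bk : bounded_measurable k by exact: bounded_measurable01.
have kC x y : k (x, y) = k (y, x) by rewrite /k tentC.
pose G x := \int[mu]_y k (x, y).
pose M := \int[mu]_x G x.
pose eps := (2 + r^-1 * L) ^+ 2 * a ^+ g.
have eps0 : 0 <= eps by rewrite mulr_ge0 ?sqr_ge0 ?exprn_ge0.
have G01 x : 0 <= G x <= 1 by apply: Rintegral01 => //; exact: bounded_measurable_sec1.
pose kappa := K * Num.sqrt Phi.
have r10 : 0 <= r^-1 by rewrite invr_ge0 ltW.
have Gk x : G x <= kappa.
  apply: le_trans (KPhi (f x)).
  have mb : measurable (f @^-1` ball (f x) r).
    rewrite ballEmdist -[X in measurable X]setTI.
    by apply: (measurable_funPT f) => //; exact: measurable_mdist_lt.
  have -> : fine (distribution mu f (ball (f x) r)) =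
      \int[mu]_y (\1_(f @^-1` ball (f x) r) y : R).
    apply: EFin_inj; rewrite Rintegral_indic// fineK//.
    exact: (fin_num_measure (mu : probability _ R)).
  apply: le_Rintegral_bounded.
  - exact: bounded_measurable_sec1.
  - exact: bounded_measurable_indic.
  - move=> y; rewrite indicE; have [yb|yb] := pselect (mdist (f x) (f y) < r).
      by rewrite mem_set/= ?ballEmdist//; have /andP[] := k01 (x, y).
    rewrite memNset/=; last by rewrite ballEmdist.
    by rewrite /k/= tent_eq0// leNgt; apply/negP.
have kmix x x' n : (0 < n)%N ->
    \int[mu]_y (k (x, iter n t y) * k (x', y)) <= G x * G x' + eps.
  move=> n0; have := @mixing_lipschitz r^-1 (tent r (f x)) (tent r (f x')) g (n * g).
  rewrite leq_pmull//; under eq_Rintegral do rewrite -iter_iter_mfun.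
  by apply => // *; rewrite ?tent01 ?tent_lipschitz.
pose H u := \int[mu]_y tent r u (f y).
have bH u : bounded_measurable (fun y => tent r u (f y)).
  apply: bounded_measurable01 => [|y]; last exact: tent01.
  by apply: measurable_tent; apply: measurable_mdist => //; exact: measurable_funPT.
have Gmix n : (0 < n)%N ->
    \int[mu]_x (G (iter n t x) * G x) <= M ^+ 2 + eps.
  move=> n0; have := @mixing_lipschitz r^-1 H H g (n * g).
  rewrite leq_pmull//; under eq_Rintegral do rewrite -iter_iter_mfun.
  have HL z z' : `|H z - H z'| <= r^-1 * mdist z z'.
    have H1 u u' : H u <= H u' + r^-1 * mdist u u'.
      rewrite -[X in _ + X](Rintegral_const mu) -RintegralD_bounded//; last first.
        exact: bounded_measurable_cst.
      apply: le_Rintegral_bounded => //.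
        by apply: bounded_measurableD => //; exact: bounded_measurable_cst.
      move=> y; have := tent_lipschitz r0 (f y) u u'.
      rewrite ler_norml !(tentC r (f y)); lra.
    rewrite ler_norml; have := H1 z z'; have := H1 z' z.
    rewrite (metric_sym z'); lra.
  by rewrite expr2; apply => // *; rewrite ?Rintegral01// => *; exact: tent01.
have := second_moment_bound (iter_mfun_inv g T_inv) mk k01 kC eps0 Gk kmix Gmix mA.
move=> /(_ m); set p := fine _.
have A0 z i j : A z -> (i < m)%N -> (j < m)%N -> k (iter i t z.1, iter j t z.2) = 0.
  by move=> Az im jm; rewrite /k/= tent_eq0// !iter_iter_mfun; exact: Ar.
move=> /(_ A0); rewrite -/M => main.
have MPhi : Phi / 2 <= M.
  rewrite PhiE corr_int_distribution// /M -Rfubini1//.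
  have mn : measurable [set z : X * X | mdist (f z.1) (f z.2) < r / 2].
    apply: measurable_mdist_lt.
      exact: measurableT_comp (measurable_funPT f) measurable_fst.
    exact: measurableT_comp (measurable_funPT f) measurable_snd.
  have -> : fine ((mu \x mu)%E [set z : X * X | mdist (f z.1) (f z.2) < r / 2]) =
      \int[(mu \x mu)%E]_z (\1_[set z : X * X | mdist (f z.1) (f z.2) < r / 2] z : R).
    by apply: EFin_inj; rewrite Rintegral_indic// fineK//;
      apply: (fin_num_measure ((mu \x mu)%E : probability _ R)).
  rewrite mulrC -RintegralZ_bounded; last exact: bounded_measurable_indic.
  apply: le_Rintegral_bounded => //.
    apply: bounded_measurableM; first exact: bounded_measurable_cst.
    exact: bounded_measurable_indic.
  move=> z; rewrite indicE.
  have [zr|zr] := pselect (mdist (f z.1) (f z.2) < r / 2).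
    by rewrite mem_set//= mulr1 tent_half.
  by rewrite memNset//= mulr0; have /andP[] := k01 z.
have mR1 : 1 <= m%:R :> R by rewrite ler1n.
rewrite (mulrC L); exact: second_moment_algebra main.
Qed.

End observed_encounters.

(** * Almost sure and deterministic asymptotics *)

Section borel_cantelli_geometric.
Context {d} {T : measurableType d} {R : realType}.
Variable P : {measure set T -> \bar R}.

(** The Borel-Cantelli lemma for geometrically decreasing probabilities. *)
Lemma ae_eventually_not (A : nat -> set T) (C rho : R) :
  (forall k, measurable (A k)) -> 0 <= C -> 0 < rho < 1 ->
  (\forall k \near \oo, (P (A k) <= (C * rho ^+ k)%:E)%E) ->
  {ae P, forall z, \forall k \near \oo, ~ A k z}.
Proof.
move=> mA C0 /andP[rho0 rho1] [k0 _ PA].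
pose B k := A (k + k0)%N.
have mB k : measurable (B k) by exact: mA.
exists (lim_sup_set B); split.
- by apply: bigcap_measurable => [|n _]; [exists 0%N | exact: bigcup_measurable].
- apply: lim_sup_set_cvg0 => //.
  apply: (@le_lt_trans _ _ (C * (1 - rho)^-1)%:E); last exact: ltry.
  apply: lime_le; first by apply: is_cvg_nneseries => n _ _.
  apply: nearW => n.
  apply: (@le_trans _ _ (series (geometric C rho) n)%:E).
    rewrite /series /= -sumEFin; apply: lee_sum => k _.
    apply: (le_trans (PA _ _)); first by rewrite /= leq_addl.
    by rewrite lee_fin ler_wpM2l// ler_wiXn2l ?leq_addr// ltW.
  rewrite lee_fin; apply: geometric_le_lim => //; rewrite ger0_norm// ltW//.
- move=> z /= nz n _; apply: contrapT => nB; apply: nz.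
  exists (n + k0)%N => // k /= nk Ak; apply: nB; exists (k - k0)%N => /=.
    by rewrite -(leq_add2r k0) subnK// (leq_trans _ nk)// leq_addl.
  by rewrite /B subnK// (leq_trans _ nk)// leq_addl.
Qed.

End borel_cantelli_geometric.

Section log_ratio.
Context {R : realType}.
Implicit Types (s w x : R).

Lemma le_lne_ratio s w x : w < 0 ->
  (s%:E <= lne x%:E / w%:E)%E = (x <= expR (s * w)).
Proof.
move=> w0; rewrite inver lt_eqF//.
have [x0|x0] := leP x 0.
  rewrite le0_lneNy ?lee_fin// (le_trans x0 (expR_ge0 _)).
  by rewrite mulNyr ltr0_sg ?invr_lt0// mulN1e leey.
rewrite lne_EFin// -EFinM lee_fin ler_ndivlMr//.
by rewrite -[RHS]ler_ln ?posrE ?expR_gt0// expRK.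
Qed.

Lemma ge_lne_ratio s w x : w < 0 ->
  (lne x%:E / w%:E <= s%:E)%E = (expR (s * w) <= x).
Proof.
move=> w0; rewrite inver lt_eqF//.
have [x0|x0] := leP x 0.
  rewrite le0_lneNy ?lee_fin// [RHS]leNgt (le_lt_trans x0 (expR_gt0 _)).
  by rewrite mulNyr ltr0_sg ?invr_lt0// mulN1e.
rewrite lne_EFin// -EFinM lee_fin ler_ndivrMr//.
by rewrite -[RHS]ler_ln ?posrE ?expR_gt0// expRK.
Qed.

End log_ratio.

Section interpolation.
Context {R : realType}.
Variables (D : nat -> R) (W : nat).
Hypothesis W1 : (1 < W)%N.
Hypothesis Dmono : forall m n, (0 < m)%N -> (m <= n)%N -> D n <= D m.

Let lnW : 0 < ln W%:R :> R.
Proof. by rewrite ln_gt0// ltr1n. Qed.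

Let lnWX k : ln (W ^ k)%:R = k%:R * ln W%:R :> R.
Proof. by rewrite natrX lnXn ?ltr0n ?(ltn_trans _ W1)// mulr_natl. Qed.

Let ln_nat_gt0 n : (1 < n)%N -> 0 < ln n%:R :> R.
Proof. by move=> n1; rewrite ln_gt0// ltr1n. Qed.

(** Bounds along the geometric sequence [W ^ k] pass to all times, at the price
    of an arbitrarily small loss in the exponent. *)
Lemma interpolate_ge (s s' : R) : 0 <= s' < s ->
  (\forall k \near \oo, D (W ^ k)%N <= expR (- (s * k%:R * ln W%:R))) ->
  \forall n \near \oo, (s'%:E <= lne (D n)%:E / (- ln n%:R)%:E)%E.
Proof.
move=> /andP[s'0 s's] [k0 _ Dk].
pose k1 := (Num.trunc (s' / (s - s'))).+1.
have ss0 : 0 < s - s' by rewrite subr_gt0.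
exists (W ^ (maxn k0 k1).+1)%N => //= n Wn.
have n1 : (1 < n)%N by apply: leq_trans Wn; rewrite -(expn0 W) ltn_exp2l.
have n0 : (0 < n)%N by exact: ltn_trans n1.
pose k := trunc_log W n.
have kk : (maxn k0 k1 <= k)%N.
  by apply: ltnW; apply: trunc_log_max.
have Wk : (W ^ k <= n)%N by exact: trunc_logP.
have nWk : (n < W ^ k.+1)%N by exact: trunc_log_ltn.
rewrite le_lne_ratio ?oppr_lt0 ?ln_nat_gt0//.
apply: (le_trans (Dmono _ Wk)); first by rewrite expn_gt0 (ltn_trans _ W1).
apply: (le_trans (Dk k _)).
  by rewrite /= (leq_trans _ kk)// leq_maxl.
rewrite ler_expR mulrN lerN2.
apply: (@le_trans _ _ (s' * (k.+1%:R * ln W%:R))).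
  rewrite ler_wpM2l// -lnWX ler_ln ?posrE ?ltr0n ?expn_gt0 ?(ltn_trans _ W1)//.
  by rewrite ler_nat ltnW.
rewrite mulrA ler_pM2r// -natr1.
have : s' / (s - s') <= k%:R.
  apply: (@le_trans _ _ k1%:R); first by rewrite ltW// truncnS_gt.
  by rewrite ler_nat (leq_trans _ kk)// leq_maxr.
rewrite ler_pdivrMr//; lra.
Qed.

Lemma interpolate_le (s s' : R) : 0 <= s < s' ->
  (\forall k \near \oo, expR (- (s * k%:R * ln W%:R)) <= D (W ^ k)%N) ->
  \forall n \near \oo, (lne (D n)%:E / (- ln n%:R)%:E <= s'%:E)%E.
Proof.
move=> /andP[s0 s's] [k0 _ Dk].
pose k1 := (Num.trunc (s / (s' - s))).+1.
have ss0 : 0 < s' - s by rewrite subr_gt0.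
exists (W ^ (maxn k0 k1).+1)%N => //= n Wn.
have n1 : (1 < n)%N by apply: leq_trans Wn; rewrite -(expn0 W) ltn_exp2l.
have n0 : (0 < n)%N by exact: ltn_trans n1.
pose k := trunc_log W n.
have kk : (maxn k0 k1 <= k)%N.
  by apply: ltnW; apply: trunc_log_max.
have Wk : (W ^ k <= n)%N by exact: trunc_logP.
have nWk : (n < W ^ k.+1)%N by exact: trunc_log_ltn.
rewrite ge_lne_ratio ?oppr_lt0 ?ln_nat_gt0//.
apply: (le_trans _ (Dmono n0 (ltnW nWk))).
apply: (le_trans _ (Dk k.+1 _)); last first.
  by rewrite /= (leq_trans _ (leqW kk))// leq_maxl.
rewrite ler_expR mulrN lerN2.
apply: (@le_trans _ _ (s' * (k%:R * ln W%:R))); last first.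
  rewrite ler_wpM2l//; first by rewrite (le_trans s0)// ltW.
  rewrite -lnWX ler_ln ?posrE ?ltr0n ?expn_gt0 ?(ltn_trans _ W1)//.
  by rewrite ler_nat.
rewrite mulrA ler_pM2r// -natr1.
have : s / (s' - s) <= k%:R.
  apply: (@le_trans _ _ k1%:R); first by rewrite ltW// truncnS_gt.
  by rewrite ler_nat (leq_trans _ kk)// leq_maxr.
rewrite ler_pdivrMr//; lra.
Qed.

(** Negative exponents are trivial lower bounds: the sequence is bounded. *)
Lemma eventually_ge_neg (s : R) : s < 0 ->
  \forall n \near \oo, (s%:E <= lne (D n)%:E / (- ln n%:R)%:E)%E.
Proof.
move=> s0.
exists (maxn 2 ((Num.trunc (expR (D 1%N / - s))).+1))%N => // n Nn.
have n1 : (1 < n)%N by exact: leq_trans (leq_maxl _ _) Nn.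
have nn := leq_trans (leq_maxr _ _) Nn; have n0 : (0 < n)%N by exact: ltn_trans n1.
rewrite le_lne_ratio ?oppr_lt0 ?ln_nat_gt0//.
apply: (le_trans (Dmono _ n0)) => //.
apply: (@le_trans _ _ (s * - ln n%:R)); last first.
  by apply: ltW; apply: (lt_le_trans _ (expR_ge1Dx _)); rewrite ltrDr.
have Dn : D 1%N / - s <= ln n%:R.
  rewrite -[leLHS]expRK ler_ln ?posrE ?expR_gt0 ?ltr0n//.
  by rewrite (le_trans (ltW (truncnS_gt _)))// ler_nat.
by move: Dn; rewrite ler_pdivrMr ?oppr_gt0//; lra.
Qed.

End interpolation.

Section limits.
Context {R : realType}.
Local Open Scope ereal_scope.

Lemma le_limn_einf (u : (\bar R)^nat) (l : R) :
  (forall j : nat, \forall n \near \oo, (l - j.+1%:R^-1)%:E <= u n) ->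
  l%:E <= limn_einf u.
Proof.
move=> lu; apply/lee_subgt0Pr => e e0.
have [j je] : exists j : nat, (j.+1%:R^-1 < e)%R.
  exists (Num.trunc e^-1); rewrite invf_plt ?posrE//; exact: truncnS_gt.
apply: (@le_trans _ _ (l - j.+1%:R^-1)%:E).
  by rewrite -EFinB lee_fin lerD2l lerN2 ltW.
rewrite limn_einf_lim; apply: lime_ge; first exact: is_cvg_einfs.
have [n0 _ h] := lu j; exists n0 => // n /= n0n.
apply: le_ereal_inf_tmp => _ [m /= nm <-]; apply: h => /=.
exact: leq_trans nm.
Qed.

Lemma cvge_of_bounds (u : (\bar R)^nat) (l : R) :
  (forall j : nat, \forall n \near \oo, (l - j.+1%:R^-1)%:E <= u n) ->
  (forall j : nat, \forall n \near \oo, u n <= (l + j.+1%:R^-1)%:E) ->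
  u n @[n --> \oo] --> l%:E.
Proof.
move=> lu ul; apply/fine_cvgP; split.
  near=> n; rewrite fin_numElt.
  rewrite (lt_le_trans (ltNyr _) (_ : (l - 1%:R^-1)%:E <= _)) ?ltNyr//=; last first.
    by near: n; exact: (lu 0%N).
  rewrite (le_lt_trans (_ : _ <= (l + 1%:R^-1)%:E)) ?ltry//.
  by near: n; exact: (ul 0%N).
apply/cvgrPdist_le => e e0.
have [j je] : exists j : nat, (j.+1%:R^-1 < e)%R.
  exists (Num.trunc e^-1); rewrite invf_plt ?posrE//; exact: truncnS_gt.
near=> n.
have h1 : (l - j.+1%:R^-1)%:E <= u n by near: n; exact: lu.
have h2 : u n <= (l + j.+1%:R^-1)%:E by near: n; exact: ul.
have : u n \is a fin_num.
  by rewrite fin_numElt (lt_le_trans _ h1) ?ltNyr// (le_lt_trans h2) ?ltry.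
move: h1 h2 => /=; case: (u n) => // v; rewrite !lee_fin/= => h1 h2 _.
rewrite ler_norml; apply/andP; split.
  by rewrite lerNl opprB lerBlDl (le_trans h2)// lerD2l ltW.
by rewrite lerBlDl -lerBlDr (le_trans _ h1)// lerD2l lerN2 ltW.
Unshelve. all: by end_near. Qed.

Lemma limf_esup_lt {T : choiceType} {X : filteredType T} (h : X -> \bar R)
    (F : set_system X) (c : \bar R) : Filter F ->
  limf_esup h F < c -> \forall r \near F, h r < c.
Proof.
move=> FF /ereal_inf_lt[_ [V FV <-] Vc].
apply: filterS FV => r Vr; apply: le_lt_trans Vc.
by apply: ereal_sup_ubound; exists r.
Qed.

Lemma limf_einf_le_esup {T : choiceType} {X : filteredType T} (h : X -> \bar R)
    (F : set_system X) : ProperFilter F ->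
  limf_einf h F <= limf_esup h F.
Proof.
move=> FF; rewrite limf_einfE; apply: ge_ereal_sup => _ [V FV <-].
apply: le_ereal_inf_tmp => _ [V' FV' <-].
have [r [Vr V'r]] := @filter_ex _ _ FF _ (@filterI _ _ FF _ _ FV FV').
apply: (@le_trans _ _ (h r)).
  by apply: ereal_inf_lbound; exists r.
by apply: ereal_sup_ubound; exists r.
Qed.

End limits.

(** * Almost sure bounds on the shortest distance *)

Lemma measurable_bigmin {d} {T : measurableType d} {R : realType} (I : Type)
    (s : seq I) (x0 : T -> R) (F : I -> T -> R) :
  measurable_fun setT x0 -> (forall i, measurable_fun setT (F i)) ->
  measurable_fun setT (fun z => \big[Num.min/x0 z]_(i <- s) F i z).
Proof.
move=> mx0 mF; elim: s => [|i s ih].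
  by under eq_fun do rewrite big_nil.
by under eq_fun do rewrite big_cons; exact: measurable_minr.
Qed.

(** A property that holds at all small scales holds eventually along
    exponentially small radii. *)
Lemma near_exp_scale {R : realType} (Q : R -> Prop) (C x : R) :
  0 < C -> 0 < x -> (\forall r \near 0^'+, Q r) ->
  \forall k \near \oo, Q (C * expR (- (x * k%:R))).
Proof.
move=> C0 x0 [e /= e0 eQ].
exists (Num.trunc (- ln (e / C) / x)).+1 => // k /= hk.
have Ck0 : 0 < C * expR (- (x * k%:R)) by rewrite mulr_gt0 ?expR_gt0.
apply: eQ => //=; rewrite sub0r normrN gtr0_norm// -ltr_pdivlMl// [ltRHS]mulrC.
rewrite -[ltRHS]lnK ?posrE ?divr_gt0// ltr_expR.
have : - ln (e / C) / x < k%:R.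
  by rewrite (lt_le_trans (truncnS_gt _))// ler_nat.
by rewrite ltr_pdivrMr//; lra.
Qed.

Section shortest_distance.
Context {R : realType} {N : nat} {d} {X : metricMeasurableType R d}.
Variables (mu : probability X R) (T : {mfun X >-> X}).
Variable (f : {mfun X >-> euclidean R N}).

Let mf_iter i : measurable_fun setT (fun x : X => f (iter i T x)).
Proof. exact: measurableT_comp (measurable_funPT f) (measurable_iter T i). Qed.

Let mdist_iter i j :
  measurable_fun setT (fun z : X * X => mdist (f (iter i T z.1)) (f (iter j T z.2))).
Proof.
apply: measurable_mdist.
  exact: measurableT_comp (mf_iter i) measurable_fst.
exact: measurableT_comp (mf_iter j) measurable_snd.
Qed.

Lemma measurable_shortest_dist n :
  measurable_fun setT (fun z : X * X => shortest_dist T f n z.1 z.2).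
Proof.
have m0 := mdist_iter 0 0.
by apply: measurable_bigmin => // i; apply: measurable_bigmin.
Qed.

Lemma le_shortest_dist n x y (r : R) : (0 < n)%N ->
  reflect (forall i j, (i < n)%N -> (j < n)%N ->
             r <= mdist (f (iter i T x)) (f (iter j T y)))
          (r <= shortest_dist T f n x y).
Proof.
move=> n0; apply: (iffP idP).
  move=> rn i j im jm; apply: (le_trans rn).
  apply: (le_trans (bigmin_le _ (Ordinal im) _)) => /=.
  exact: (bigmin_le _ (Ordinal jm) _).
move=> h; have h0 := h _ _ n0 n0.
by apply: le_bigmin => // i _; apply: le_bigmin => // j _; exact: h.
Qed.

Lemma shortest_dist_nonincreasing x y m n : (0 < m)%N -> (m <= n)%N ->
  shortest_dist T f n x y <= shortest_dist T f m x y.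
Proof.
move=> m0 mn; apply/le_shortest_dist => // i j im jm.
have n0 := leq_trans m0 mn.
have /(le_shortest_dist _ _ _ n0) := lexx (shortest_dist T f n x y).
by apply; exact: leq_trans mn.
Qed.
End shortest_distance.

Lemma four_expn k : (4 ^ k = 2 ^ k * 2 ^ k)%N.
Proof. by rewrite -expnMn. Qed.

Section almost_sure_bounds.
Context {R : realType} {N : nat} {d} {X : metricMeasurableType R d}.
Variables (mu : probability X R) (T : {mfun X >-> X}).
Hypothesis T_inv : forall A, measurable A -> mu (T @^-1` A) = mu A.
Variable (f : {mfun X >-> euclidean R N}).
Local Notation nu := (distribution mu f).

Let Dlt_meas n (r : R) : measurable [set z : X * X | shortest_dist T f n z.1 z.2 < r].
Proof.
have := measurable_shortest_dist T f n measurableT (measurable_itv `]-oo, r[).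
by rewrite setTI; congr measurable; apply/seteqP; split => z /=; rewrite in_itv.
Qed.

Let Dge_meas n (r : R) : measurable [set z : X * X | r <= shortest_dist T f n z.1 z.2].
Proof.
have := measurable_shortest_dist T f n measurableT (measurable_itv `[r, +oo[).
rewrite setTI; congr measurable; apply/seteqP; split => z /=;
  by rewrite in_itv/= andbT.
Qed.

Let mdist_f : measurable_fun setT (fun z : X * X => mdist (f z.1) (f z.2)).
Proof.
apply: measurable_mdist.
  exact: measurableT_comp (measurable_funPT f) measurable_fst.
exact: measurableT_comp (measurable_funPT f) measurable_snd.
Qed.

(** Union bound over the [n ^ 2] pairs of times. *)
Lemma probability_shortest_dist_lt n (r : R) : (0 < n)%N ->
  fine ((mu \x mu)%E [set z : X * X | shortest_dist T f n z.1 z.2 < r]) <=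
    n%:R ^+ 2 * corr_int nu r.
Proof.
move=> n0.
pose C := [set z : X * X | mdist (f z.1) (f z.2) < r].
have mC : measurable C.
  have := mdist_f measurableT (measurable_itv `]-oo, r[); rewrite setTI.
  by congr measurable; apply/seteqP; split => z /=; rewrite in_itv.
pose k : X * X -> R := \1_C.
have bk : bounded_measurable k by exact: bounded_measurable_indic.
have k01 z : 0 <= k z <= 1 by rewrite /k indicE; case: (_ \in _); rewrite /= ?lexx ?ler01.
have PE A : measurable A -> fine ((mu \x mu)%E A) = \int[(mu \x mu)%E]_z (\1_A z : R).
  move=> mA; apply: EFin_inj; rewrite Rintegral_indic// fineK//.
  exact: (fin_num_measure ((mu \x mu)%E : probability _ R)).
have kM i j : \int[(mu \x mu)%E]_z k (iter i T z.1, iter j T z.2) = corr_int nu r.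
  have -> : corr_int nu r = \int[(mu \x mu)%E]_z k z.
    rewrite corr_int_distribution; last exact: measurable_mdist.
    exact: (PE C mC).
  have [mk _] := bk; apply: (etrans (Rintegral_encounter T_inv mk k01 i j)).
  by rewrite -(Rfubini1 mu mu bk).
have bkij i j : bounded_measurable (fun z : X * X => k (iter i T z.1, iter j T z.2)).
  apply: bounded_measurable_comp bk; apply: measurable_fun_pair.
    exact: measurableT_comp (measurable_iter T i) measurable_fst.
  exact: measurableT_comp (measurable_iter T j) measurable_snd.
rewrite PE//.
apply: (@le_trans _ _ (\int[(mu \x mu)%E]_z
    \sum_(p : 'I_n * 'I_n) k (iter p.1 T z.1, iter p.2 T z.2))).
  apply: le_Rintegral_bounded; first exact: bounded_measurable_indic.
    by apply: bounded_measurable_sum => p.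
  move=> z; have k0 (p : 'I_n * 'I_n) : 0 <= k (iter p.1 T z.1, iter p.2 T z.2).
    by have /andP[] := k01 (iter p.1 T z.1, iter p.2 T z.2).
  have [zr|zr] := pselect (shortest_dist T f n z.1 z.2 < r); last first.
    by rewrite indicE memNset//=; apply: sumr_ge0 => p _.
  rewrite indicE mem_set//=.
  have [i [j [im jm ijr]]] : exists i j, [/\ (i < n)%N, (j < n)%N &
      mdist (f (iter i T z.1)) (f (iter j T z.2)) < r].
    apply: contrapT => H; move: zr; rewrite ltNge => /negP; apply.
    apply/le_shortest_dist => // i j im jm; rewrite leNgt; apply/negP => ijr.
    by apply: H; exists i, j.
  rewrite (bigD1 (Ordinal im, Ordinal jm))//=.
  by rewrite {1}/k indicE mem_set//= lerDl; apply: sumr_ge0 => p _.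
rewrite Rintegral_sum_bounded => [|p]; last exact: bkij.
under eq_bigr do rewrite kM.
by rewrite sumr_const card_prod card_ord -[leLHS]mulr_natl natrM expr2.
Qed.

(** If the correlation integral at scale [r] is at most [r ^ c], then [2 / c]
    bounds the decay exponent from above: the union bound is summable along
    [n = 2 ^ k]. *)
Lemma ae_dist_ratio_le (c s : R) : 0 < s -> 2 < s * c ->
  (\forall r \near 0^'+, corr_int nu r <= expR (c * ln r)) ->
  {ae (mu \x mu)%E, forall z : X * X, forall s', s < s' ->
     \forall n \near \oo, (dist_ratio T f z.1 z.2 n <= s'%:E)%E}.
Proof.
move=> s0 sc2 nuc.
pose l := ln 2 : R; have l0 : 0 < l by rewrite ln_gt0// ltr1n.
pose r k := expR (- (s * k%:R * l)).
pose A k := [set z : X * X | shortest_dist T f (2 ^ k) z.1 z.2 < r k].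
have PA : \forall k \near \oo,
    ((mu \x mu)%E (A k) <= (1 * expR (- ((s * c - 2) * l)) ^+ k)%:E)%E.
  have := near_exp_scale ltr01 (mulr_gt0 s0 l0) nuc.
  apply: filterS => k; rewrite !mul1r mulrAC -/(r k) => nuk.
  rewrite -[leLHS]fineK; last first.
    apply: (fin_num_measure ((mu \x mu)%E : probability _ R)); exact: Dlt_meas.
  rewrite lee_fin (le_trans (probability_shortest_dist_lt _ _))// ?expn_gt0//.
  apply: (@le_trans _ _ ((2 ^ k)%:R ^+ 2 * expR (c * ln (r k)))).
    by rewrite ler_wpM2l ?sqr_ge0.
  have -> : (2 ^ k)%:R = expR (k%:R * l) :> R.
    by rewrite expRM_natl /l lnK ?posrE// natrX.
  rewrite -!expRM_natl -expRD expRK ler_expR; lra.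
have := ae_eventually_not (fun k => Dlt_meas (2 ^ k) (r k)) ler01 _ PA.
have -> : 0 < expR (- ((s * c - 2) * l)) < 1.
  by rewrite expR_gt0 expR_lt1 oppr_lt0 mulr_gt0// subr_gt0.
move=> /(_ isT); apply: filterS => z Az s' ss'.
apply: (@interpolate_le _ (fun n => shortest_dist T f n z.1 z.2) 2%N _ _ s s') => //.
- by move=> m n; exact: shortest_dist_nonincreasing.
- by rewrite ss' ltW.
- by apply: filterS Az => k /negP; rewrite -leNgt.
Qed.

(** With [p] large, the [2 ^ (p * k)] multiples of the gap [4 ^ k] below
    [n = 2 ^ ((p + 2) * k)] are [n] in number, up to an arbitrarily small loss in the
    exponent. *)
Let exists_block_exponent (x : R) : 0 < x < 2 ->
  exists p : nat, 0 < 2 * p%:R - x * (p + 2)%:R.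
Proof.
move=> /andP[x0 x2]; pose y := 2 * x / (2 - x).
have d0 : 0 < 2 - x by rewrite subr_gt0.
exists (Num.trunc y).+1.
have : y < (Num.trunc y).+1%:R by exact: truncnS_gt.
by rewrite natrD /y ltr_pdivrMr//; move: (_.+1%:R) => q; lra.
Qed.

(** The mixing error at gap [4 ^ k] is smaller than any geometric sequence. *)
Let mixing_error_small (a B : R) : 0 <= a < 1 ->
  \forall k \near \oo, a ^+ (4 ^ k) <= expR (- (B * k%:R)).
Proof.
move=> /andP[a0 a1].
have [q aq] : exists q, a ^+ q <= expR (- B).
  have : (GRing.exp a : R^nat) n @[n --> \oo] --> (0 : R).
    by apply: cvg_expr; rewrite ger0_norm.
  move=> /cvgrPdist_le/(_ _ (expR_gt0 (- B)))[q _ /(_ q (leqnn q))].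
  rewrite sub0r normrN ger0_norm ?exprn_ge0// => h; by exists q.
exists q => // k /= qk.
apply: (@le_trans _ _ (a ^+ (q * k))).
  apply: ler_wiXn2l => //; first exact: ltW.
  have k2 : (k < 2 ^ k)%N by exact: ltn_expl.
  rewrite four_expn.
  by apply: leq_mul; [exact: leq_trans qk (ltnW k2) | exact: ltnW].
rewrite -mulNr mulrC expRM_natl exprM.
by rewrite lerXn2r ?nnegrE ?exprn_ge0 ?expR_ge0.
Qed.

Variables (Y : set (euclidean R N)) (L alpha a : R).
Hypothesis L0 : 0 <= L.
Hypothesis fL : forall x x', mdist (f x) (f x') <= L * mdist x x'.
Hypothesis alpha01 : 0 < alpha <= 1.
Hypothesis a01 : 0 <= a < 1.
Hypothesis decay : forall psi phi : euclidean R N -> R,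
  holder Y alpha psi -> holder Y alpha phi ->
  forall n : nat, (0 < n)%N ->
    (`|\int[mu]_x (psi (f (iter n T x)) * phi (f x))
        - (\int[mu]_x psi (f x)) * (\int[mu]_x phi (f x))|%:E
     <= holder_norm setT alpha (psi \o f) *
        holder_norm setT alpha (phi \o f) * (a ^+ n)%:E)%E.

(** If the correlation integral at scale [r] is at least [r ^ c], then [2 / c]
    bounds the decay exponent from below: along [n = W ^ k], the orbits sampled
    at [2 ^ (p * k)] times with gap [4 ^ k] fail to meet with geometrically small
    probability. *)
Lemma ae_dist_ratio_ge (c s : R) : 0 < s -> 0 < c -> s * c < 2 ->
  (\forall r \near 0^'+, expR (c * ln r) <= corr_int nu r) ->
  {ae (mu \x mu)%E, forall z : X * X, forall s', 0 <= s' < s ->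
     \forall n \near \oo, (s'%:E <= dist_ratio T f z.1 z.2 n)%E}.
Proof.
move=> s0 c0 sc2 nuc.
have sc0 : 0 < s * c by exact: mulr_gt0.
have [p p0] : exists p : nat, 0 < 2 * p%:R - s * c * (p + 2)%:R.
  by apply: exists_block_exponent; rewrite sc0.
have l20 : 0 < ln 2 :> R by rewrite ln_gt0// ltr1n.
pose W := (2 ^ (p + 2))%N.
pose l := ln W%:R : R.
have lE : l = (p + 2)%:R * ln 2 by rewrite /l /W natrX lnXn// mulr_natl.
have l0 : 0 < l by rewrite lE mulr_gt0// ltr0n addn2.
(* [m ^ 2 * Phi], with [m = 2 ^ (p * k)], grows at least like [expR (k * delta)] *)
pose delta := (2 * p%:R - s * c * (p + 2)%:R) * ln 2.
have delta0 : 0 < delta by exact: mulr_gt0.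
have deltaE : delta = 2 * p%:R * ln 2 - s * c * l by rewrite lE /delta; ring.
pose r k := expR (- (s * k%:R * l)).
have r0 k : 0 < r k by exact: expR_gt0.
pose A k := [set z : X * X | r k <= shortest_dist T f (W ^ k) z.1 z.2].
have mE : measurable_fun setT (fun p : euclidean R N * euclidean R N => mdist p.1 p.2).
  exact: measurable_mdist.
have [K [K0 nuK]] := measure_ball_le_corr_int mE nu (@euclidean_half_covering R N).
pose b := expR (c * ln 2).
pose C := 2 * b + 4 * K * expR (c * ln 2 / 2) + 16 * (2 + L) ^+ 2 * b ^+ 2.
(* the rate that the mixing error must have to absorb the factors [r k ^- 2] and
   [Phi ^- 2] that come with it *)
pose B := 2 * s * l + 2 * c * s * l + delta / 2.
have PA : \forall k \near \oo,
    ((mu \x mu)%E (A k) <= (C * expR (- (delta / 2)) ^+ k)%:E)%E.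
  have half0 : 0 < 2^-1 :> R by rewrite invr_gt0.
  near=> k.
  have nuk : expR (c * ln (r k / 2)) <= corr_int nu (r k / 2).
    rewrite /r mulrAC [_ / 2]mulrC; near: k.
    exact: near_exp_scale half0 (mulr_gt0 s0 l0) nuc.
  have ak : a ^+ (4 ^ k) <= expR (- (B * k%:R)).
    by near: k; exact: mixing_error_small.
  rewrite -[leLHS]fineK; last first.
    apply: (fin_num_measure ((mu \x mu)%E : probability _ R)); exact: Dge_meas.
  rewrite lee_fin.
  set Phi := corr_int nu (r k / 2) in nuk.
  have lnr : ln (r k / 2) = - (s * k%:R * l) - ln 2.
    by rewrite lnM ?posrE// lnV ?posrE// expRK.
  have Phi0 : 0 < Phi by apply: lt_le_trans nuk; exact: expR_gt0.
  have mkE : (2 ^ (p * k))%:R = expR (k%:R * (p%:R * ln 2)) :> R.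
    by rewrite !expRM_natl lnK ?posrE// natrX exprM.
  have m2Phi : expR (k%:R * delta - c * ln 2) <= (2 ^ (p * k))%:R ^+ 2 * Phi.
    apply: (@le_trans _ _ ((2 ^ (p * k))%:R ^+ 2 * expR (c * ln (r k / 2)))); last first.
      by rewrite ler_wpM2l ?sqr_ge0.
    by rewrite mkE -expRM_natl -expRD lnr ler_expR deltaE; lra.
  have mk0 : (0 < 2 ^ (p * k))%N by rewrite expn_gt0.
  have gk0 : (0 < 4 ^ k)%N by rewrite expn_gt0.
  have := @encounter_probability _ _ _ _ _ _ T_inv _ _ _ _ _ L0 fL alpha01 a01 decay
    K (r k) Phi (2 ^ (p * k)) (4 ^ k) (A k) (r0 k) mk0 gk0 K0
    (fun u => nuK u (r k) (r0 k)) erefl Phi0 (Dge_meas _ _).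
  have Wk : (2 ^ (p * k) * 4 ^ k = W ^ k)%N.
    by rewrite /W four_expn -expnM -!expnD mulnDl mul2n -addnn.
  have Wk0 : (0 < W ^ k)%N by rewrite -Wk muln_gt0 mk0.
  have Ar z i j : A k z -> (i < 2 ^ (p * k))%N -> (j < 2 ^ (p * k))%N ->
      r k <= mdist (f (iter (i * 4 ^ k) T z.1)) (f (iter (j * 4 ^ k) T z.2)).
    move=> Az im jm.
    have h := elimT (@le_shortest_dist _ _ _ _ T f _ z.1 z.2 (r k) Wk0) Az.
    by apply: h; rewrite -Wk ltn_pmul2r.
  move=> /(_ Ar) /le_trans; apply.
  rewrite -expRM_natl /C [leRHS]mulrDl [X in _ <= X + _]mulrDl.
  apply: lerD; first apply: lerD.
  - apply: (@le_trans _ _ (2 * expR (- (k%:R * delta - c * ln 2)))).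
      by rewrite expRN ler_wpM2l// lef_pV2 ?posrE ?expR_gt0// mulr_gt0// exprn_gt0 ?ltr0n.
    rewrite -mulrA ler_wpM2l// /b -expRD ler_expR mulrN.
    suff : 0 <= k%:R * delta by lra.
    by rewrite mulr_ge0// ltW.
  - apply: (@le_trans _ _ (4 * K * expR (- ((k%:R * delta - c * ln 2) / 2)))).
      rewrite expRN ler_wpM2l ?mulr_ge0// lef_pV2 ?posrE ?expR_gt0//; last first.
        by rewrite mulr_gt0 ?ltr0n// sqrtr_gt0.
      rewrite -(@ler_pXn2r _ 2)// ?nnegrE ?expR_ge0//.
      rewrite exprMn sqr_sqrtr; last exact: ltW.
      by rewrite -expRM_natl mulrC divfK.
    rewrite -[X in _ <= X]mulrA ler_wpM2l ?mulr_ge0// -expRD ler_expR; lra.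
  - have r1 : r k <= 1.
      by rewrite /r -expR0 ler_expR oppr_le0 !mulr_ge0// ltW.
    have rV : (r k)^-1 = expR (s * k%:R * l) by rewrite -expRN opprK.
    have Lr : (2 + L / r k) ^+ 2 <= (2 + L) ^+ 2 * expR (2 * (s * k%:R * l)).
      rewrite expRM_natl -exprMn -rV.
      rewrite lerXn2r ?nnegrE ?addr_ge0 ?mulr_ge0 ?invr_ge0 ?(ltW (r0 k))//.
        by rewrite addr_ge0.
      rewrite mulrDl lerD2r ler_peMr//.
      by rewrite -[leLHS]invr1 lef_pV2 ?posrE.
    have PhiV : Phi ^- 2 <= expR (2 * (c * (s * k%:R * l + ln 2))).
      rewrite expRM_natl -exprVn lerXn2r ?nnegrE ?expR_ge0 ?invr_ge0 ?(ltW Phi0)//.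
      have -> : c * (s * k%:R * l + ln 2) = - (c * ln (r k / 2)) by rewrite lnr; ring.
      by rewrite expRN lef_pV2 ?posrE ?expR_gt0.
    apply: (@le_trans _ _ (16 * (((2 + L) ^+ 2 * expR (2 * (s * k%:R * l))) *
        expR (- (B * k%:R))) * expR (2 * (c * (s * k%:R * l + ln 2))))).
      have /andP[a0 _] := a01.
      apply: ler_pM => //.
      + apply: mulr_ge0 => //; apply: mulr_ge0; first exact: sqr_ge0.
        exact: exprn_ge0.
      + by rewrite invr_ge0 exprn_ge0// ltW.
      + rewrite ler_wpM2l//; apply: ler_pM => //; first exact: sqr_ge0.
        exact: exprn_ge0.
    have -> : b ^+ 2 = expR (2 * (c * ln 2)) by rewrite expRM_natl.
    rewrite -[leRHS]mulrA -expRD.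
    set e1 := expR (2 * (s * _ * _)); set e2 := expR (- _).
    set e3 := expR (2 * (c * (_ + _))).
    have -> : 16 * ((2 + L) ^+ 2 * e1 * e2) * e3 = 16 * (2 + L) ^+ 2 * (e1 * e2 * e3).
      by ring.
    rewrite ler_wpM2l//; first by apply: mulr_ge0 => //; exact: sqr_ge0.
    rewrite /e1 /e2 /e3 -!expRD ler_expR /B; lra.
have W1 : (1 < W)%N by rewrite /W addn2 (@ltn_exp2l 2 0).
have C0 : 0 <= C.
  apply: addr_ge0; first apply: addr_ge0.
  - by rewrite mulr_ge0// expR_ge0.
  - by rewrite !mulr_ge0// expR_ge0.
  - by apply: mulr_ge0; [apply: mulr_ge0 => // |]; exact: sqr_ge0.
have := ae_eventually_not (fun k => Dge_meas (W ^ k) (r k)) C0 _ PA.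
have -> : 0 < expR (- (delta / 2)) < 1.
  by rewrite expR_gt0 expR_lt1 oppr_lt0 divr_gt0.
move=> /(_ isT); apply: filterS => z Az s' ss'.
apply: (@interpolate_ge _ (fun n => shortest_dist T f n z.1 z.2) W W1 _ s s') => //.
- by move=> m n; exact: shortest_dist_nonincreasing.
- by apply: filterS Az => k /negP; rewrite -ltNge => /ltW.
Unshelve. all: by end_near. Qed.

End almost_sure_bounds.

(** * Correlation dimensions and the theorem *)

Section correlation_dimension.
Context {R : realType} {d} {E : metricMeasurableType R d}.
Hypothesis mE : measurable_fun setT (fun p : E * E => mdist p.1 p.2).
Variable nu : probability E R.

Let near01 (Q : R -> Prop) : (\forall r \near 0^'+, 0 < r < 1 -> Q r) ->
  \forall r \near 0^'+, Q r.
Proof.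
move=> h; apply: filterS3 h (nbhs_right_gt 0) (nbhs_right_lt ltr01) => r Qr r0 r1.
by apply: Qr; rewrite r0.
Qed.

Let ln_lt0 (r : R) : 0 < r < 1 -> ln r < 0.
Proof. by move=> /ln_lt0. Qed.

Lemma corr_ratio_lt (c : R) : (\forall r \near 0^'+, (corr_ratio nu r < c%:E)%E) ->
  \forall r \near 0^'+, expR (c * ln r) <= corr_int nu r.
Proof.
move=> h; apply: near01; apply: filterS h => r + r01.
rewrite /corr_ratio -corr_int_fin// ltNge le_lne_ratio; last exact: ln_lt0.
by rewrite -ltNge => /ltW.
Qed.

Lemma corr_ratio_gt (c : R) : (\forall r \near 0^'+, (c%:E < corr_ratio nu r)%E) ->
  \forall r \near 0^'+, corr_int nu r <= expR (c * ln r).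
Proof.
move=> h; apply: near01; apply: filterS h => r + r01.
rewrite /corr_ratio -corr_int_fin// => /ltW.
by rewrite le_lne_ratio; last exact: ln_lt0.
Qed.

End correlation_dimension.

Lemma cvge_near_lt {R : realType} {T : Type} {F : set_system T} {FF : Filter F}
    (h : T -> \bar R) (C : \bar R) (c : R) :
  h r @[r --> F] --> C -> (C < c%:E)%E -> \forall r \near F, (h r < c%:E)%E.
Proof.
case: C => [C||] hC Cc //; last exact: cvgeNy_lt.
rewrite lte_fin in Cc.
exact: (hC _ (@nbhs_open_ereal_lt _ C (fun=> c) Cc)).
Qed.

Lemma cvge_near_gt {R : realType} {T : Type} {F : set_system T} {FF : Filter F}
    (h : T -> \bar R) (C : \bar R) (c : R) :
  h r @[r --> F] --> C -> (c%:E < C)%E -> \forall r \near F, (c%:E < h r)%E.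
Proof.
case: C => [C||] hC Cc //; last exact: cvgey_gt.
rewrite lte_fin in Cc.
exact: (hC _ (@nbhs_open_ereal_gt _ C (fun=> c) Cc)).
Qed.

Section observed_orbits_theorem.
Context {R : realType} {N : nat} {d} {X : metricMeasurableType R d}.
Variables (mu : probability X R) (T : {mfun X >-> X}).
Hypothesis T_inv : forall A, measurable A -> mu (T @^-1` A) = mu A.
Variables (Y : set (euclidean R N)) (f : {mfun X >-> euclidean R N}).
Variable alpha : R.
Hypothesis f_lipschitz : exists L : R, forall x x' : X,
  mdist (f x) (f x') <= L * mdist x x'.
Hypothesis alpha01 : 0 < alpha <= 1.
Hypothesis H1 : exponential_decay mu T Y f alpha.
Local Notation nu := (distribution mu f).

(** If the correlation ratio is eventually below every [c > 2 / v], then [v] is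
    almost surely a lower bound for the decay exponent; [v = 0] stands for an
    infinite dimension and only says that the shortest distance is bounded. *)
Lemma ae_dist_ratio_ge_all (v : R) : 0 <= v ->
  (forall c, 0 < c -> 2 < v * c -> \forall r \near 0^'+, (corr_ratio nu r < c%:E)%E) ->
  {ae (mu \x mu)%E, forall z : X * X, forall j : nat,
     \forall n \near \oo, ((v - j.+1%:R^-1)%:E <= dist_ratio T f z.1 z.2 n)%E}.
Proof.
move=> v0 hv.
have mE : measurable_fun setT (fun p : euclidean R N * euclidean R N => mdist p.1 p.2).
  exact: measurable_mdist.
have [L' fL'] := f_lipschitz.
pose L := Num.max L' 0.
have L0 : 0 <= L by rewrite le_max lexx orbT.
have fL x x' : mdist (f x) (f x') <= L * mdist x x'.
  by apply: (le_trans (fL' x x')); rewrite ler_wpM2r ?mdist_ge0// le_max lexx.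
have [a [a01 decay]] := H1.
apply: ae_foralln => j; set q := j.+1%:R^-1.
have q0 : 0 < q by rewrite invr_gt0 ltr0n.
have [vq|vq] := ltP (v - q) 0.
  apply: (@aeW _ _ _ _ _ _) => z.
  apply: (@eventually_ge_neg _ (fun n => shortest_dist T f n z.1 z.2)) => //.
  by move=> m n; exact: shortest_dist_nonincreasing.
have v1 : 0 < v by lra.
pose s := v - q / 2; pose c := (2 / v + 2 / s) / 2.
have s0 : 0 < s by rewrite /s; lra.
have sv : s < v by rewrite /s; lra.
have vs : 2 / v < 2 / s by rewrite ltr_pM2l// ltf_pV2 ?posrE.
have c1 : 2 / v < c by rewrite /c; lra.
have c2 : c < 2 / s by rewrite /c; lra.
have c0 : 0 < c by apply: lt_trans c1; rewrite divr_gt0.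
have sc2 : s * c < 2 by rewrite mulrC -ltr_pdivlMr.
have vc2 : 2 < v * c by rewrite mulrC -ltr_pdivrMr.
have := ae_dist_ratio_ge T_inv L0 fL alpha01 a01 decay s0 c0 sc2
  (corr_ratio_lt mE (hv _ c0 vc2)).
by apply: filterS => z; apply; rewrite vq/= /s; lra.
Qed.

(** The counterpart for upper bounds of the decay exponent. *)
Lemma ae_dist_ratio_le_all (v : R) : 0 <= v ->
  (forall s, v < s -> exists c, 2 < s * c /\
     \forall r \near 0^'+, (c%:E < corr_ratio nu r)%E) ->
  {ae (mu \x mu)%E, forall z : X * X, forall j : nat,
     \forall n \near \oo, (dist_ratio T f z.1 z.2 n <= (v + j.+1%:R^-1)%:E)%E}.
Proof.
move=> v0 hv.
have mE : measurable_fun setT (fun p : euclidean R N * euclidean R N => mdist p.1 p.2).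
  exact: measurable_mdist.
apply: ae_foralln => j; set q := j.+1%:R^-1.
have q0 : 0 < q by rewrite invr_gt0 ltr0n.
have [|c [sc2 nuc]] := hv (v + q / 2); first by lra.
have s0 : 0 < v + q / 2 by lra.
have := ae_dist_ratio_le T_inv s0 sc2 (corr_ratio_gt mE nuc).
by apply: filterS => z; apply; lra.
Qed.

End observed_orbits_theorem.

(** The number [2 / C], for a positive and possibly infinite dimension [C], seen
    as a threshold between exponents. *)
Lemma two_div_dim {R : realType} (C : \bar R) : (0 < C)%E ->
  exists2 v : R, (2%:E / C = v%:E)%E & 0 <= v /\
    (forall c : R, 2 < v * c -> (C < c%:E)%E) /\
    (forall s : R, v < s -> exists2 c : R, 2 < s * c & (c%:E < C)%E).
Proof.
case: C => [C||]// C0; last first.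
  exists 0; first by rewrite invey mule0.
  split=> //; split=> [c|s s0]; first by rewrite mul0r ltrn0.
  exists (3 / s); last exact: ltry.
  by rewrite mulrC divfK ?gt_eqF// ltr_nat.
rewrite lte_fin in C0.
exists (2 / C); first by rewrite inver gt_eqF// -EFinM.
split; first by rewrite divr_ge0// ltW.
split=> [c|s].
  by rewrite lte_fin mulrAC ltr_pdivlMr// ltr_pM2l.
rewrite ltr_pdivrMr// => sC.
have s0 : 0 < s.
  move: sC; rewrite mulrC -ltr_pdivrMl// => /(lt_trans _); apply.
  by rewrite mulr_gt0// invr_gt0.
have h : 2 / s < C by rewrite ltr_pdivrMr// mulrC.
exists ((2 / s + C) / 2); last by rewrite lte_fin; lra.
by rewrite mulrC -ltr_pdivrMr//; lra.
Qed.

Unset Implicit Arguments.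

Theorem theorem3p4 (R : realType) (N : nat) (d : measure_display)
    (X : metricMeasurableType R d) (mu : probability X R)
    (T : {mfun X >-> X})
    (T_invariant : forall A : set X, measurable A -> mu (T @^-1` A) = mu A)
    (Y : set (euclidean R N)) (f : {mfun X >-> euclidean R N})
    (f_range : forall x : X, Y (f x))
    (f_lipschitz : exists L : R, forall x x' : X,
       mdist (f x) (f x') <= L * mdist x x')
    (alpha : R) (alpha_range : 0 < alpha <= 1)
    (lower_dim_gt0 : (0 < lower_corr_dim (distribution mu f))%E)
    (H1 : exponential_decay mu T Y f alpha)
    (HA : annulus_regular (distribution mu f)) :
  {ae (mu \x mu)%E, forall z : X * X,
     (2%:E / upper_corr_dim (distribution mu f) <=
        limn_einf (dist_ratio T f z.1 z.2))%E} /\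
  (forall C : \bar R, is_corr_dim (distribution mu f) C ->
     {ae (mu \x mu)%E, forall z : X * X,
        dist_ratio T f z.1 z.2 n @[n --> \oo] --> (2%:E / C)%E}).
Proof.
split.
  have C0 : (0 < upper_corr_dim (distribution mu f))%E.
    apply: (lt_le_trans lower_dim_gt0); exact: limf_einf_le_esup.
  have [v -> [v0 [vC _]]] := two_div_dim C0.
  have dim_lt c : 0 < c -> 2 < v * c ->
      \forall r \near 0^'+, (corr_ratio (distribution mu f) r < c%:E)%E.
    by move=> _ /vC; exact: limf_esup_lt.
  have h := ae_dist_ratio_ge_all T_invariant f_lipschitz alpha_range H1 v0 dim_lt.
  by apply: filterS h => z; exact: le_limn_einf.
move=> C hC.
(* [C] is at least any positive lower bound of the ratios at small scales *)
have C0 : (0 < C)%E.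
  have : (0 < lower_corr_dim (distribution mu f))%E by [].
  rewrite /lower_corr_dim limf_einfE => /ereal_sup_gt[_ [V FV <-]] V0.
  have [e [e0 eV]] : exists e : R, 0 < e /\
      (e%:E < ereal_inf [set corr_ratio (distribution mu f) x | x in V])%E.
    move: V0; case: (ereal_inf _) => [y||] //.
      rewrite lte_fin => y0; exists (y / 2); rewrite lte_fin; split; lra.
    by move=> _; exists 1; rewrite ltry.
  rewrite ltNge; apply/negP => C0.
  have h : \forall r \near 0^'+, (corr_ratio (distribution mu f) r < e%:E)%E.
    by apply: cvge_near_lt hC _; rewrite (le_lt_trans C0)// lte_fin.
  have [r [/= Vr re]] := @filter_ex _ _ _ _ (@filterI _ _ _ _ _ FV h).
  have : (e%:E < corr_ratio (distribution mu f) r)%E.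
    by apply: (lt_le_trans eV); apply: ereal_inf_lbound; exists r.
  by rewrite ltNge (ltW re).
have [v -> [v0 [vC Cv]]] := two_div_dim C0.
have dim_lt c : 0 < c -> 2 < v * c ->
    \forall r \near 0^'+, (corr_ratio (distribution mu f) r < c%:E)%E.
  by move=> _ /vC; exact: cvge_near_lt hC.
have dim_gt s : v < s -> exists c, 2 < s * c /\
    \forall r \near 0^'+, (c%:E < corr_ratio (distribution mu f) r)%E.
  by move=> /Cv[c sc cC]; exists c; split => //; exact: cvge_near_gt hC cC.
have hge := ae_dist_ratio_ge_all T_invariant f_lipschitz alpha_range H1 v0 dim_lt.
have hle := ae_dist_ratio_le_all T_invariant v0 dim_gt.
by apply: filterS2 hge hle => z; exact: cvge_of_bounds.
Qed.
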